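(* Let $d\ge2$ and $k,m\ge1$ be integers. If $i\mid k$ for every $i\in\{1,\dots,m\}$, then the rough Veronese variety $\mathcal{R}_{d,k,m}$ is projectively normal.
   Context: Let $T((\mathbb{R}^d))=\prod_{k\ge 0}(\mathbb{R}^d)^{\otimes k}$ be the algebra of formal power series in non-commuting variables $x_1,\dots,x_d$ (product: tensor/concatenation product), and let $p_k:T((\mathbb{R}^d))\to(\mathbb{R}^d)^{\otimes k}$ be the projection. Let $\mathrm{Lie}(\mathbb{R}^d)$ be the smallest vector subspace containing $x_1,\dots,x_d$ and closed under $[T,S]=TS-ST$, and let $\mathrm{Lie}^m(\mathbb{R}^d)$ be its truncation to tensor orders at most $m$ (regarded inside $T((\mathbb{R}^d))$). Put $\exp(L)=\sum_{n\ge0}L^{\otimes n}/n!$. The rough Veronese variety $\mathcal{R}_{d,k,m}\subset\mathbb{P}^{d^k-1}$ (over $\mathbb{C}$) is the Zariski closure of the image of the composition $\mathrm{Lie}^m(\mathbb{R}^d)\xrightarrow{\exp}T((\mathbb{R}^d))\xrightarrow{p_k}(\mathbb{R}^d)^{\otimes k}\to(\mathbb{C}^d)^{\otimes k}\dashrightarrow\mathbb{P}^{d^k-1}$. A non-empty word $w$ in the alphabet $\{1,\dots,d\}$ is Lyndon if whenever $w=pq$ with $p,q$ nonempty words, $w<q$ in lexicographic order. Let $W_{d,m}$ be the set of Lyndon words of length at most $m$. Let $S=\mathbb{C}[x_w\mid w\in W_{d,m}]$ be graded by giving $x_w$ weight equal to the length of $w$, let $A$ be the set of monomials of $S$ of weighted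 degree $k$, and let $R=\mathbb{C}[y_\alpha\mid\alpha\in A]$ with the standard grading. It is known that, after a linear change of coordinates, $\mathcal{R}_{d,k,m}$ lies in the linear subspace $\mathrm{Proj}\,R=\mathbb{P}^{\#A-1}$ of $\mathbb{P}^{d^k-1}$, and its homogeneous prime ideal there is the kernel of the ring homomorphism $R\to S$, $y_\alpha\mapsto\alpha$. A projective variety is projectively normal if the affine cone over it is a normal variety. *)

(* Defs.v *)
From HB Require Import structures.
From mathcomp Require Import all_boot all_order all_algebra.
From mathcomp Require Import boolp classical_sets reals.
From mathcomp Require Import complex mpoly.

Set Implicit Arguments.
Unset Strict Implicit.
Unset Printing Implicit Defensive.

Import GRing.Theory Num.Theory.

Local Open Scope ring_scope.
Local Open Scope classical_set_scope.

(* A noncommutative formal power series in x_0, ..., x_(d-1) is the family of *)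
(* its coefficients on words; on words of length k these are the coordinates  *)
(* of its component in the k-th tensor power.  The library's ring structure   *)
(* on functions is pointwise, hence the separate product [ncmul].             *)
Definition ncseries (K : Type) (d : nat) := seq 'I_d -> K.

Definition nc1 (K : nzRingType) (d : nat) : ncseries K d :=
  fun w => (w == [::])%:R.
Arguments nc1 K d : clear implicits.

Definition ncvar (K : nzRingType) (d : nat) (i : 'I_d) : ncseries K d :=
  fun w => (w == [:: i])%:R.
Arguments ncvar K {d} i.

Definition ncmul (K : nzRingType) (d : nat) (f g : ncseries K d) :
    ncseries K d :=
  fun w => \sum_(i < (size w).+1) f (take i w) * g (drop i w).

Definition ncpow (K : nzRingType) (d : nat) (f : ncseries K d) (n : nat) :
    ncseries K d :=
  iter n (ncmul f) (nc1 K d).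

Definition ncbracket (K : nzRingType) (d : nat) (f g : ncseries K d) :
    ncseries K d :=
  fun w => ncmul f g w - ncmul g f w.

Definition nctrunc (K : nzRingType) (d m : nat) (f : ncseries K d) :
    ncseries K d :=
  fun w => if (size w <= m)%N then f w else 0.

(* The powers f^n with n > |w| do not contribute to the coefficient of w when *)
(* f has no constant term, see [ncexpE]; all Lie series satisfy this, see     *)
(* [lie_const0].                                                              *)
Definition ncexp (K : fieldType) (d : nat) (f : ncseries K d) : ncseries K d :=
  fun w => \sum_(n < (size w).+1) ncpow f n w / n`!%:R.

Definition is_subspace (K : nzRingType) (d : nat) (V : set (ncseries K d)) :=
  V (fun=> 0) /\
  forall (a : K) f g, V f -> V g -> V (fun w => a * f w + g w).

Definition is_lie_subspace (K : nzRingType) (d : nat)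
    (V : set (ncseries K d)) :=
  is_subspace V /\ forall f g, V f -> V g -> V (ncbracket f g).

Definition lie (K : nzRingType) (d : nat) : set (ncseries K d) :=
  smallest (@is_lie_subspace K d) (range (@ncvar K d)).
Arguments lie K d : clear implicits.

Definition lie_trunc (K : nzRingType) (d m : nat) : set (ncseries K d) :=
  nctrunc m @` lie K d.
Arguments lie_trunc K d m : clear implicits.

Lemma ncpow_eq0 (K : nzRingType) (d : nat) (f : ncseries K d) n w :
  f [::] = 0 -> (size w < n)%N -> ncpow f n w = 0.
Proof.
move=> f0; elim: n w => [|n IHn] w //; rewrite ltnS => le_wn.
rewrite /ncpow iterS -/(ncpow f n) /ncmul big1 // => -[[|i] lt_iw] _ /=.
  by rewrite take0 f0 mul0r.
rewrite IHn ?mulr0 // size_drop (leq_trans _ le_wn) // ltn_subrL /=.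
by case: (size w) lt_iw.
Qed.

Lemma ncexpE (K : fieldType) (d : nat) (f : ncseries K d) N w :
  f [::] = 0 -> (size w <= N)%N ->
  ncexp f w = \sum_(n < N.+1) ncpow f n w / n`!%:R.
Proof.
move=> f0 le_wN; rewrite /ncexp.
rewrite (big_ord_widen N.+1 (fun n => ncpow f n w / n`!%:R)) ?ltnS //.
rewrite [RHS](bigID (fun n : 'I__ => (n < (size w).+1)%N)) /=.
rewrite [X in _ + X]big1 ?addr0 // => n; rewrite -leqNgt => lt_wn.
by rewrite ncpow_eq0 ?mul0r.
Qed.

Lemma lie_const0 (K : nzRingType) (d : nat) (f : ncseries K d) :
  lie K d f -> f [::] = 0.
Proof.
apply: (_ : lie K d `<=` [set g | g [::] = 0]).
apply: smallest_sub => [|_ [i _ <-] //]; split=> [|g h /= g0 h0].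
  by split=> //= a g h g0 h0; rewrite g0 h0 mulr0 addr0.
by rewrite /ncbracket /ncmul !big_ord1 /= g0 h0 mulr0 subr0.
Qed.

(* The projective space of lines through 0 in K^n, i.e. of dimension n - 1.   *)
Definition projspace (K : fieldType) (n : nat) :=
  {U : {vspace 'rV[K]_n} | \dim U == 1%N}.

Fact proj_point_subproof (K : fieldType) (n : nat) (v : 'rV[K]_n) :
  v != 0 -> \dim <[v]>%VS == 1%N.
Proof. by move=> v_neq0; rewrite dim_vline v_neq0. Qed.

Definition proj_point (K : fieldType) (n : nat) (v : 'rV[K]_n)
    (v_neq0 : v != 0) : projspace K n :=
  exist _ <[v]>%VS (proj_point_subproof v_neq0).

Definition proj_zeros (K : fieldType) (n : nat) (F : set {mpoly K[n]}) :
    set (projspace K n) :=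
  [set U : projspace K n |
     forall f, F f -> forall v : 'rV[K]_n, v \in val U -> f.@[v 0] = 0].

Definition proj_closed (K : fieldType) (n : nat) (X : set (projspace K n)) :=
  exists2 F : set {mpoly K[n]},
    (forall f, F f -> exists e, f \is e.-homog) & X = proj_zeros F.

Definition proj_closure (K : fieldType) (n : nat) (X : set (projspace K n)) :
    set (projspace K n) :=
  smallest (@proj_closed K n) X.

Definition affine_cone (K : fieldType) (n : nat) (X : set (projspace K n)) :
    set 'rV[K]_n :=
  [set v | v = 0 \/ exists2 U : projspace K n, X U & v \in val U].

Definition vanishing_ideal (K : fieldType) (n : nat) (Z : set 'rV[K]_n) :
    set {mpoly K[n]} :=
  [set f : {mpoly K[n]} | forall v : 'rV[K]_n, Z v -> f.@[v 0] = 0].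

(* A, together with phi, is the quotient of K[X_1, ..., X_n] by the vanishing *)
(* ideal of Z.                                                                *)
Definition is_coordinate_ring (K : fieldType) (n : nat) (Z : set 'rV[K]_n)
    (A : nzRingType) (phi : {rmorphism {mpoly K[n]} -> A}) :=
  (forall a, exists f, phi f = a) /\
  (forall f, phi f = 0 <-> vanishing_ideal Z f).

Definition integrally_closed (A : idomainType) :=
  forall x : {fraction A}, integralOver (@tofrac A) x ->
    exists a, x = tofrac a.

(* The existence of A as an integral domain says that Z is irreducible.       *)
Definition normal_affine_variety (K : fieldType) (n : nat)
    (Z : set 'rV[K]_n) :=
  exists (A : idomainType) (phi : {rmorphism {mpoly K[n]} -> A}),
    is_coordinate_ring Z phi /\ integrally_closed A.

Definition projectively_normal (K : fieldType) (n : nat)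
    (X : set (projspace K n)) :=
  normal_affine_variety (affine_cone X).

Definition nb_words (d k : nat) := #|{: k.-tuple 'I_d}|.

Lemma nb_wordsE d k : nb_words d k = (d ^ k)%N.
Proof. by rewrite /nb_words card_tuple card_ord. Qed.

Definition tensor_proj (K : nzRingType) (d k : nat) (f : ncseries K d) :
    'rV[K]_(nb_words d k) :=
  \row_j f (enum_val j : k.-tuple 'I_d).

Definition rough_veronese_map (R : realType) (d k : nat) (L : ncseries R d) :
    'rV[R[i]]_(nb_words d k) :=
  map_mx (real_complex R) (tensor_proj k (ncexp L)).

Definition rough_veronese (R : realType) (d k m : nat) :
    set (projspace R[i] (nb_words d k)) :=
  proj_closure
    [set U | exists (L : ncseries R d) (L_neq0 : rough_veronese_map k L != 0),
       lie_trunc R d m L /\ U = proj_point L_neq0].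
Arguments rough_veronese R d k m : clear implicits.

(* Main.v *)
Require Import Defs.
From HB Require Import structures.
From mathcomp Require Import all_boot all_order all_algebra.
From mathcomp Require Import generic_quotient boolp classical_sets reals.
From mathcomp Require Import complex mpoly.
From mathcomp Require Import zify.

(** The idea is to identify the coordinate ring of the affine cone with a
    Veronese subring of a weighted polynomial ring, and to see that the
    divisibility hypothesis makes this identification onto.

    Choose a basis [b_1, ..., b_N] of the truncated Lie algebra made of
    homogeneous elements, [b_j] having degree [wt j] between 1 and [m]
    ([homogeneous_lie_basis]).  For [L = \sum_j t_j b_j] the coefficient of
    [exp L] at a word [w] is a polynomial [coord w] in [t], homogeneous of
    degree [size w] when [t_j] has weight [wt j].  So [X_w |-> coord w], for
    words [w] of length [k], is a ring morphism from the homogeneous coordinate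
    ring of projective space to the subring of [C[t_1, ..., t_N]] spanned by the
    monomials whose weight is a multiple of [k] ([pullback], [veronese]).

    Its kernel is the vanishing ideal of the cone: a polynomial vanishes on the
    image of the real parametrization exactly when its pullback vanishes at all
    real points, i.e. is zero ([exists_nat_nonroot]); and as the pullback
    multiplies degrees by [k] ([pullback_pihomog]), the kernel is homogeneous,
    which is what allows passing to the closure in projective space.

    Its image is the whole Veronese subring ([pullback_surj]), for two reasons.
    First, the coefficients at words of length [e] span all polynomials of
    weight [e] ([word_span_monomial]).  Indeed [exp L] is group-like, so that a
    product of two coefficients is a sum of coefficients over shuffles
    ([algexp_shuffle]); and the linear part of the coefficients recovers the
    variables, the other terms being products of variables of smaller weight.
    Secondly, when every [i <= m] divides [k], a monomial whose weight is a
    nonzero multiple of [k] has a divisor of weight exactly [k]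
    ([exists_subset_sum]), so that monomials of weight [k] generate.

    Finally the Veronese subring is integrally closed: polynomial rings over a
    field are ([completely_integrally_closed_mpoly]), and a quotient of two
    elements of the subring which is a polynomial again belongs to the subring
    ([veronese_quotient]). *)

Set Implicit Arguments.
Unset Strict Implicit.
Unset Printing Implicit Defensive.

Import GRing.Theory Num.Theory.

(** * Subsets with prescribed sum *)

Section FiniteSubsets.
(* The sets of this section are finite sets, not the classical ones. *)
Import mathcomp.boot.fintype mathcomp.boot.finset.

Section SubsetSums.
Variables (I : finType) (w : I -> nat).

Let wsum (A : {set I}) := (\sum_(i in A) w i)%N.

Lemma subset_of_card (A : {set I}) n :
  (n <= #|A|)%N -> exists2 B : {set I}, B \subset A & #|B| = n.
Proof.
move=> le_nA; exists [set x in take n (enum A)].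
  by apply/subsetP=> x; rewrite inE => /mem_take; rewrite mem_enum.
rewrite cardsE (card_uniqP _) ?take_uniq ?enum_uniq //.
by rewrite size_takel // -cardE.
Qed.

(** Either [C] itself is small enough, or two of the [g + 1] partial sums of
    [g] elements of [C] agree modulo [g]. *)
Lemma exists_zero_sum_subset (C : {set I}) g :
  (0 < g)%N -> C != set0 -> (g %| wsum C)%N ->
  exists D : {set I},
    [/\ D \subset C, D != set0, (#|D| <= g)%N & (g %| wsum D)%N].
Proof.
move=> g_gt0 C_neq0 dvd_gC.
have [le_Cg|lt_gC] := leqP #|C| g; first by exists C.
pose s := enum C.
have sz_s : size s = #|C| by rewrite /s -cardE.
(* Partial sums; the elements between two that agree modulo [g] form [D]. *)
pose P j := (\sum_(i <- take j s) w i)%N.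
pose f (j : 'I_g.+1) : 'I_g := Ordinal (ltn_pmod (P j) g_gt0).
have /injectivePn[j1 [j2 neq_j eq_f]] : ~~ injectiveb f.
  apply/injectiveP=> /leq_card; rewrite !card_ord; lia.
wlog lt_j : j1 j2 neq_j eq_f / (j1 < j2)%N.
  move=> wl; have [lt|lt|/val_inj e] := ltngtP j1 j2; first exact: (wl j1 j2).
    by apply: (wl j2 j1); rewrite // eq_sym.
  by rewrite e eqxx in neq_j.
pose t := drop j1 (take j2 s).
have ut : uniq t by rewrite drop_uniq // take_uniq // enum_uniq.
have st : size t = (j2 - j1)%N.
  rewrite size_drop size_takel // sz_s; have := ltn_ord j2; lia.
have cardD : #|[set x in t]| = (j2 - j1)%N.
  by rewrite cardsE (card_uniqP _).
exists [set x in t]; split.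
- apply/subsetP=> x; rewrite inE => /mem_drop /mem_take.
  by rewrite mem_enum.
- by rewrite -card_gt0 cardD subn_gt0.
- rewrite cardD; have := ltn_ord j2; lia.
have eqP2 : P j2 = (P j1 + wsum [set x in t])%N.
  rewrite /P -(cat_take_drop j1 (take j2 s)) big_cat /= take_takel ?(ltnW lt_j) //.
  congr addn; rewrite -/t big_uniq //.
  by apply: eq_bigl => x; rewrite inE.
move: eq_f => /(congr1 val) /= /eqP.
by rewrite eqP2 eq_sym -{2}[P j1]addn0 eqn_modDl mod0n.
Qed.

Lemma wsum_class (g : nat) (B : {set I}) :
  B \subset [set i | w i == g] -> wsum B = (g * #|B|)%N.
Proof.
move=> /subsetP sB; rewrite /wsum (eq_bigr (fun=> g)) ?sum_nat_const 1?mulnC //.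
by move=> i /sB; rewrite inE => /eqP.
Qed.

(** Fill the target [k] with elements of weight different from [g] first,
    keeping the sum divisible by [g] and at most [k], as large as possible.  The
    gap that remains is a multiple of [g].  It is less than [g * m], since
    otherwise a zero-sum subset modulo [g] of the unused elements would still
    fit; so there are enough elements of weight [g] to close it.  If there is no
    unused element left, the elements of weight [g] close the gap because the
    total is at least [k]. *)
Lemma subset_sum_of_large_class (m k g : nat) :
  (0 < k)%N -> (0 < g)%N -> (g %| k)%N ->
  (forall i, (0 < w i <= m)%N) -> (k %| wsum setT)%N -> (0 < wsum setT)%N ->
  (m <= #|[set i | w i == g]|.+1)%N ->
  exists J : {set I}, wsum J = k.
Proof.
move=> k_gt0 g_gt0 dvd_gk w_bd dvd_kT T_gt0 G_big.
set G := [set i | w i == g] in G_big.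
have sumU (A B : {set I}) :
    [disjoint A & B] -> wsum (A :|: B) = (wsum A + wsum B)%N.
  by move=> dAB; rewrite /wsum -bigU //=; apply: eq_bigl => i; rewrite !inE.
have splitT : wsum setT = (wsum G + wsum (~: G))%N.
  by rewrite -sumU ?setUCr // -setI_eq0 setICr.
have sumG : wsum G = (g * #|G|)%N by apply: wsum_class.
pose ok (J : {set I}) := [&& J \subset ~: G, g %| wsum J & wsum J <= k]%N.
have ok0 : ok set0 by rewrite /ok sub0set /wsum big_set0 dvdn0.
case: (arg_maxnP (P := ok) wsum ok0) => J /and3P[sJ dvdJ le_Jk] maxJ.
suff fill : (k - wsum J <= g * #|G|)%N.
  have dvd_d : (g %| k - wsum J)%N by rewrite dvdn_sub.
  have /subset_of_card[B sBG cB] : ((k - wsum J) %/ g <= #|G|)%N.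
    by rewrite leq_divLR // mulnC.
  exists (J :|: B); rewrite sumU; last first.
    rewrite disjoint_sym (disjointWl sBG) // disjoint_sym.
    by rewrite disjoints_subset.
  by rewrite (wsum_class sBG) cB mulnC divnK // subnKC.
pose C := ~: G :\: J.
have splitC : wsum (~: G) = (wsum J + wsum C)%N.
  rewrite -sumU; last by rewrite disjoint_sym disjoints_subset subsetDr.
  by congr wsum; rewrite /C -[LHS](setID _ J) (setIidPr sJ).
have [C0|C_neq0] := eqVneq C set0.
  have /dvdn_leq : (k %| wsum setT)%N by [].
  move=> /(_ T_gt0); rewrite splitT splitC C0 [wsum set0]big_set0 sumG; lia.
have dvdC : (g %| wsum C)%N.
  have : (g %| wsum setT)%N by apply: dvdn_trans dvd_kT.
  by rewrite splitT sumG dvdn_addr ?dvdn_mulr // splitC dvdn_addr.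
have [D [sD D_neq0 cD dvdD]] := exists_zero_sum_subset g_gt0 C_neq0 dvdC.
have dJD : [disjoint J & D].
  by rewrite disjoint_sym disjoints_subset (subset_trans sD) // subsetDr.
have D_gt0 : (0 < wsum D)%N.
  case/set0Pn: D_neq0 => x xD; rewrite /wsum (bigD1 x) //=.
  by case/andP: (w_bd x); lia.
have D_le : (wsum D <= g * m)%N.
  apply: leq_trans (_ : \sum_(i in D) m <= _)%N.
    by apply: leq_sum => i _; case/andP: (w_bd i).
  by rewrite sum_nat_const leq_mul2r cD orbT.
have lt_k : (k < wsum J + wsum D)%N.
  rewrite ltnNge; apply/negP=> le_k.
  have := maxJ (J :|: D); rewrite /ok sumU // subUset sJ le_k dvdn_addr //.
  by rewrite dvdD (subset_trans sD) ?subsetDl //= => /(_ isT); lia.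
have /dvdnP[q eq_q] : (g %| k - wsum J)%N by rewrite dvdn_sub.
rewrite eq_q mulnC leq_mul2l; apply/orP; right.
suff : (q < m)%N by lia.
rewrite -(ltn_pmul2l g_gt0) mulnC -eq_q; lia.
Qed.

End SubsetSums.

(** The factor 2 is needed because [m.+3] and [m.+1] may both be even. *)
Lemma dvdn_consecutive3 (m k : nat) :
  (forall i, (1 <= i <= m.+3)%N -> (i %| k)%N) ->
  (m.+3 * m.+2 * m.+1 %| 2 * k)%N.
Proof.
move=> dvd_k.
have d1 : (m.+3 * m.+2 %| k)%N.
  by rewrite Gauss_dvd ?coprimeSn // !dvd_k //; lia.
have d2 : (m.+1 %| k)%N by apply: dvd_k; lia.
rewrite -muln_lcm_gcd mulnC dvdn_mul //; last by rewrite dvdn_lcm d1 d2.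
have : (gcdn (m.+3 * m.+2) m.+1 %| m.+3 * m.+2)%N by apply: dvdn_gcdl.
rewrite [X in (_ %| X)%N -> _](_ : _ = m.+1 * m.+4 + 2)%N; last by lia.
by rewrite dvdn_addr // dvdn_mulr // dvdn_gcdr.
Qed.

(** If no weight class is large enough for [subset_sum_of_large_class], each
    class has at most [m - 2] elements, so the total is at most
    [(m - 2) * m * (m + 1) / 2].  Unless the total is [k], it is at least
    [2 * k], which is a multiple of [m * (m - 1) * (m - 2)].  This is a
    contradiction for [m > 3]; for [m = 3] one uses [k >= m * (m - 1)], and for
    [m < 3] the total would be 0. *)
Lemma exists_subset_sum (I : finType) (w : I -> nat) (m k : nat) :
  (0 < k)%N -> (forall j, (1 <= j <= m)%N -> (j %| k)%N) ->
  (forall i, (0 < w i <= m)%N) ->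
  (k %| \sum_i w i)%N -> (0 < \sum_i w i)%N ->
  exists J : {set I}, (\sum_(i in J) w i)%N = k.
Proof.
move=> k_gt0 dvd_k w_bd dvd_T T_gt0.
have eT : (\sum_(i in [set: I]) w i = \sum_i w i)%N.
  by apply: eq_bigl => i; rewrite inE.
have [/existsP[g big_g]|/existsPn small] :=
  boolP [exists g : 'I_m, (m <= #|[set i | w i == g.+1]|.+1)%N].
  apply: (subset_sum_of_large_class (m := m) (g := g.+1)); rewrite ?eT //.
  by apply: dvd_k; rewrite ltn_ord.
have [eq_kT|neq_kT] := eqVneq (\sum_i w i)%N k.
  by exists setT; rewrite eT.
have ge2k : (2 * k <= \sum_i w i)%N.
  by case/dvdnP: dvd_T T_gt0 neq_kT => [[|[|q]]] ->; rewrite ?mul1n ?eqxx //; nia.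
have le_T : (\sum_i w i <= \sum_(g < m) g.+1 * m.-2)%N.
  have -> : (\sum_i w i = \sum_i \sum_(g < m | w i == g.+1) g.+1)%N.
    apply: eq_bigr => i _; case/andP: (w_bd i) => wi0 wim.
    have lt_wi : ((w i).-1 < m)%N by lia.
    rewrite (big_pred1 (Ordinal lt_wi)) /=; first by lia.
    by move=> g; rewrite /= -val_eqE /=; lia.
  rewrite (exchange_big_dep xpredT) //=; apply: leq_sum => g _.
  rewrite sum_nat_const mulnC leq_mul2l /=.
  have small_g := small g; apply: (@leq_trans #|[set i | w i == g.+1]|).
    by rewrite cardsE; apply/eq_leq/eq_card.
  lia.
have sum_tri : (2 * \sum_(g < m) g.+1 * m.-2 = m * m.+1 * m.-2)%N.
  rewrite -big_distrl /= mulnA; congr (_ * _)%N.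
  elim: (m) => [|n IHn]; first by rewrite big_ord0.
  by rewrite big_ord_recr /= mulnDr IHn; lia.
case: m dvd_k w_bd small le_T sum_tri => [|[|[|n]]] dvd_k w_bd _ le_T sum_tri;
  try by lia.
have le3 : (n.+3 * n.+2 * n.+1 <= 2 * k)%N.
  by apply: dvdn_leq; [lia | apply: dvdn_consecutive3].
have le2 : (n.+3 * n.+2 <= k)%N.
  apply: dvdn_leq => //.
  by rewrite Gauss_dvd ?coprimeSn // !dvd_k //; lia.
have le_S := leq_trans ge2k le_T.
rewrite -(leq_pmul2l (isT : 0 < 2)%N) sum_tri /= in le_S.
by case: n le3 le2 le_S {dvd_k w_bd le_T sum_tri} => [|n] le3 le2 le_S; nia.
Qed.

End FiniteSubsets.

Local Open Scope ring_scope.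

(** * Complete integral closedness of polynomial rings *)

(** Complete integral closedness, which says that a fraction [a / b] whose
    powers have a common denominator [c] lies in [A], written without fractions.
    For this property, passing to polynomial rings only takes a short argument
    on leading coefficients. *)
Definition completely_integrally_closed (A : idomainType) :=
  forall c a b : A, c != 0 -> b != 0 ->
    (forall n, exists e, c * a ^+ n = e * b ^+ n) -> exists h, a = h * b.

Lemma completely_integrally_closed_field (K : fieldType) :
  completely_integrally_closed K.
Proof. by move=> c a b _ b_neq0 _; exists (a / b); rewrite divfK. Qed.

(** After removing the gcd, [b] is coprime to [a], so all its powers divide [c];
    hence [b] is constant. *)
Lemma completely_integrally_closed_poly_field (K : fieldType) :
  completely_integrally_closed {poly K}.
Proof.
move=> c a b c_neq0 b_neq0 ab.
have g_neq0 : gcdp a b != 0 by rewrite gcdp_eq0 (negbTE b_neq0) andbF.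
pose b' := b %/ gcdp a b; pose a' := a %/ gcdp a b.
have eb : b = b' * gcdp a b by rewrite divpK ?dvdp_gcdr.
have ea : a = a' * gcdp a b by rewrite divpK ?dvdp_gcdl.
have cop : coprimep b' a' by rewrite coprimep_sym coprimep_div_gcd // b_neq0 orbT.
have b'_neq0 : b' != 0 by apply: contraNneq b_neq0 => b'0; rewrite eb b'0 mul0r.
have dvd_c n : b' ^+ n %| c.
  have [e eq_e] := ab n.
  rewrite -(@Gauss_dvdpl _ _ (a' ^+ n)) ?coprimep_expl ?coprimep_expr //.
  apply/dvdpP; exists e; apply: (@mulIf _ (gcdp a b ^+ n)); first exact: expf_neq0.
  by rewrite -!mulrA -!exprMn -ea -eb.
have sz_b' : size b' = 1%N.
  apply/eqP; rewrite eqn_leq size_poly_gt0 b'_neq0 andbT leqNgt; apply/negP=> lt1.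
  have /(leq_sub2r 1) := dvdp_leq c_neq0 (dvd_c (size c)).
  rewrite !subn1 size_exp; apply/negP; rewrite -ltnNge.
  have c_gt0 : (0 < size c)%N by rewrite size_poly_gt0.
  case: (size b') lt1 => [|[|n]] //= _.
  by rewrite (leq_trans _ (leq_pmull _ _)) ?prednK.
have [u u_neq0 eq_b'] : exists2 u, u != 0 & b' = u%:P.
  by apply/size_poly1P; rewrite sz_b'.
exists (u^-1 *: a'); rewrite {1}ea {2}eb eq_b'.
rewrite -mul_polyC mulrA [u^-1%:P * _]mulrC -[_ * u%:P]mulrA.
by rewrite -polyCM mulVf // mulr1.
Qed.

Lemma tofrac_inj (A : idomainType) : injective (@tofrac A).
Proof. by move=> a b /eqP; rewrite tofrac_eq => /eqP. Qed.

Lemma fraction_repr (A : idomainType) (x : {fraction A}) :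
  exists a b, b != 0 /\ x * tofrac b = tofrac a.
Proof.
elim/quotW: x => r; exists \n_r, \d_r; split; first exact: denom_ratioP.
unlock tofrac; rewrite -[LHS]FracField.pi_mul /FracField.mulf.
rewrite !numden_Ratio ?oner_neq0 // mulr1.
apply/eqmodP; rewrite /= FracField.equivfE.
rewrite !numden_Ratio ?oner_neq0 ?mulf_neq0 ?oner_neq0 ?denom_ratioP //.
by rewrite !mulr1 mulrC.
Qed.

(** Over the fraction field of [A], [b] divides [a].  The leading coefficient
    [l] of the quotient [h] is almost integral over [A], hence in [A]; and
    [h - l X^n] is again almost integral, with the same denominator [c], so
    that one concludes by induction on the degree. *)
Lemma completely_integrally_closed_poly (A : idomainType) :
  completely_integrally_closed A -> completely_integrally_closed {poly A}.
Proof.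
move=> cicA c a b c_neq0 b_neq0 ab.
pose iota : {rmorphism {poly A} -> {poly {fraction A}}} := map_poly (@tofrac A).
have iota_inj : injective iota.
  by apply: map_inj_poly; [exact: tofrac_inj | exact: rmorph0].
have iota_eq0 p : (iota p == 0) = (p == 0).
  by rewrite -(inj_eq iota_inj) rmorph0.
have [h eq_h] : exists h, iota a = h * iota b.
  apply: (@completely_integrally_closed_poly_field _ (iota c)); rewrite ?iota_eq0 // => n.
  by have [e eq_e] := ab n; exists (iota e); rewrite -!rmorphXn -!rmorphM eq_e.
suff [h' eq_h'] : exists h', h = iota h'.
  by exists h'; apply: iota_inj; rewrite eq_h eq_h' rmorphM.
have h_almost n : exists e, iota c * h ^+ n = iota e.
  have [e eq_e] := ab n; exists e; apply: (@mulIf _ (iota b ^+ n)).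
    by rewrite expf_neq0 // iota_eq0.
  by rewrite -mulrA -exprMn -eq_h -!rmorphXn -!rmorphM eq_e.
move: h_almost {eq_h}.
have [N] := ubnP (size h); elim: N h => // N IHN h lt_hN h_almost.
have [->|h_neq0] := eqVneq h 0; first by exists 0; rewrite rmorph0.
have [l eq_l] : exists l, lead_coef h = tofrac l.
  have [p [q [q_neq0 eq_pq]]] := fraction_repr (lead_coef h).
  have [l eq_l] : exists l, p = l * q.
    apply: (cicA (lead_coef c)); rewrite ?lead_coef_eq0 // => n.
    have [e eq_e] := h_almost n; exists (lead_coef e).
    apply: tofrac_inj; rewrite !tofracM !tofracXn -eq_pq exprMn mulrA.
    congr (_ * _).
    have := congr1 (@lead_coef _) eq_e.
    rewrite lead_coefM lead_coef_exp !lead_coef_map_inj //; exact: tofrac_inj.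
  exists l; apply: (@mulIf _ (tofrac q)); first by rewrite tofrac_eq0.
  by rewrite eq_pq eq_l tofracM.
pose d := (size h).-1.
pose t := iota (l *: 'X^d).
have et : t = lead_coef h *: 'X^d.
  by rewrite /t /iota /= map_polyZ map_polyXn eq_l.
have [|n|h' eq_h'] := IHN (h - t).
- apply: (@leq_trans (size h)); last by rewrite -ltnS.
  have hs : size h = d.+1 by rewrite prednK // size_poly_gt0.
  rewrite hs ltnS; apply/leq_sizeP => j le_j; rewrite coefB et coefZ coefXn.
  case: (ltngtP j d) le_j => // [lt_j _|-> _]; last by rewrite mulr1 subrr.
  rewrite mulr0 subr0 nth_default //; by rewrite hs.
- have /choice[e eq_e] := h_almost.
  exists (\sum_(i < n.+1)
    ((-1) ^+ i * (e (n - i)%N * (l *: 'X^d) ^+ i) *+ 'C(n, i))).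
  rewrite exprBn mulr_sumr [RHS]rmorph_sum; apply: eq_bigr => i _.
  rewrite mulrnAr [RHS]rmorphMn; congr (_ *+ _).
  rewrite !rmorphM !rmorphXn rmorphN1 -eq_e -/t.
  by rewrite !mulrA [iota c * _]mulrC.
by exists (h' + l *: 'X^d); rewrite [RHS]rmorphD /= -eq_h' subrK.
Qed.

Section MultivariateAsUnivariate.
Variables (R : nzRingType) (n : nat).
Local Notation widen := (widen_ord (leqnSn _)).

Lemma muni_widenX (i : 'I_n) : muni ('X_(widen i) : {mpoly R[n.+1]}) = ('X_i)%:P.
Proof.
rewrite /muni mmapX mmap1U; case: splitP => [j eq_ij|j].
  by congr ('X__)%:P; apply/val_inj/esym.
by rewrite ord1 /= addn0 => /eqP /=; rewrite ltn_eqF.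
Qed.

Lemma muni_maxX : muni ('X_ord_max : {mpoly R[n.+1]}) = 'X.
Proof.
rewrite /muni mmapX mmap1U; case: splitP => //; case=> j lt_jn /eqP /=.
by have := lt_jn; rewrite ltn_neqAle eq_sym => /andP[/negbTE->].
Qed.

Lemma muni_inj : injective (@muni n R).
Proof.
suff muni0P (p : {mpoly R[n.+1]}) : muni p = 0 -> p = 0.
  move=> p q eq_pq; apply/eqP; rewrite -subr_eq0; apply/eqP/muni0P.
  by rewrite muniB eq_pq subrr.
move=> up0; apply/mpolyP => m; rewrite mcoeff0.
have eq0 : (muni p)`_(m ord_max) = 0 by rewrite up0 coef0.
have := congr1 (mcoeff [multinom m (widen i) | i < n]) eq0; rewrite mcoeff0 => <-.
rewrite muniE coef_sum raddf_sum /=.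
have eq_m (m' : 'X_{1..n.+1}) :
    ([multinom m' (widen i) | i < n] == [multinom m (widen i) | i < n])
      && (m ord_max == m' ord_max) = (m' == m).
  apply/andP/eqP=> [[/eqP/mnmP e1 /eqP e2]|->]; last by rewrite !eqxx.
  apply/mnmP=> i; case: (unliftP ord_max i) => [j ->|->] //.
  have -> : lift ord_max j = widen j by apply/val_inj; rewrite /= /bump leqNgt ltn_ord.
  by have := e1 j; rewrite !mnmE.
rewrite (eq_bigr (fun m' => p@_m' * (m' == m)%:R)); last first.
  move=> m' _; rewrite coefZ coefXn -eq_m.
  case: eqP => _; rewrite ?andbT ?andbF ?mulr1 ?mulr0 ?mcoeff0 //.
  by rewrite mcoeffZ mcoeffX.
have [m_in|m_out] := boolP (m \in msupp p).
  rewrite (bigD1_seq m) ?msupp_uniq //= eqxx mulr1 big1 ?addr0 // => m' /negbTE->.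
  by rewrite mulr0.
rewrite memN_msupp_eq0 // big1_seq // => m' /= m'_in.
case: eqP => [eq_m'|_]; rewrite ?mulr0 //.
by rewrite -eq_m' m'_in in m_out.
Qed.
End MultivariateAsUnivariate.

Lemma muni_surj (R : comNzRingType) n (q : {poly {mpoly R[n]}}) :
  exists p : {mpoly R[n.+1]}, muni p = q.
Proof.
have muni_widen (c : {mpoly R[n]}) : muni (mwiden c) = c%:P.
  rewrite /mwiden /mmap raddf_sum [c in RHS]mpolyE raddf_sum.
  apply: eq_bigr => m _ /=.
  rewrite -mul_mpolyC muniM muniC rmorphM /=; congr (_ * _).
  rewrite /mmap1 mpolyXE_id !rmorph_prod.
  by apply: eq_bigr => i _; rewrite !rmorphXn /= muni_widenX.
exists (\sum_(i < size q) mwiden q`_i * 'X_ord_max ^+ i).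
rewrite raddf_sum -[RHS]coefK poly_def; apply: eq_bigr => i _ /=.
by rewrite rmorphM rmorphXn /= muni_widen muni_maxX mul_polyC.
Qed.

Lemma completely_integrally_closed_mpoly (K : fieldType) n :
  completely_integrally_closed {mpoly K[n]}.
Proof.
elim: n => [|n IHn] c a b c_neq0 b_neq0 ab.
  have [] := @completely_integrally_closed_field K c@_0 a@_0 b@_0.
  - by apply: contraNneq c_neq0 => c0; rewrite [c]nvar0_mpolyC c0.
  - by apply: contraNneq b_neq0 => b0; rewrite [b]nvar0_mpolyC b0.
  - move=> i; have [e eq_e] := ab i; exists e@_0.
    move: eq_e; rewrite [a]nvar0_mpolyC [b]nvar0_mpolyC [c]nvar0_mpolyC [e]nvar0_mpolyC.
    rewrite -!(rmorphXn (@mpolyC 0 K)) -!(rmorphM (@mpolyC 0 K)).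
    by move=> /(congr1 (mcoeff 0)); rewrite !mcoeffC eqxx !mulr1.
  move=> h eq_h; exists h%:MP.
  by rewrite [a]nvar0_mpolyC [b]nvar0_mpolyC -rmorphM eq_h.
have muni_eq0 (p : {mpoly K[n.+1]}) : (muni p == 0) = (p == 0).
  by rewrite -(inj_eq (@muni_inj K n)) muni0.
have [] := completely_integrally_closed_poly IHn
  (c := muni c) (a := muni a) (b := muni b); rewrite ?muni_eq0 //.
  move=> i; have [e eq_e] := ab i; exists (muni e).
  by have := congr1 (@muni n K) eq_e; rewrite !muniM !rmorphXn.
move=> h' eq_h'; have [h eq_h] := muni_surj h'; exists h.
by apply: muni_inj; rewrite eq_h' muniM eq_h.
Qed.

(** Induction on the number of variables, as a nonzero univariate polynomial has
    finitely many roots.  So a polynomial vanishing at all real points is 0. *)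
Lemma exists_nat_nonroot (K : numFieldType) n (f : {mpoly K[n]}) :
  f != 0 ->
  exists v : 'I_n -> nat, f.@[fun i => (v i)%:R] != 0.
Proof.
elim: n f => [|n IHn] f f_neq0.
  exists (fun=> 0%N); rewrite [f]nvar0_mpolyC mevalC.
  by apply: contraNneq f_neq0 => f0; rewrite [f]nvar0_mpolyC f0.
have uf_neq0 : muni f != 0.
  by apply: contraNneq f_neq0 => uf0; apply/eqP/muni_inj; rewrite uf0 muni0.
have [] := IHn (lead_coef (muni f)); rewrite ?lead_coef_eq0 // => v' lc_neq0.
pose ev : {rmorphism {mpoly K[n]} -> K} := meval (fun i => (v' i)%:R).
pose g := map_poly ev (muni f).
have g_neq0 : g != 0.
  apply: contraNneq lc_neq0 => g0; rewrite lead_coefE.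
  by rewrite -[_.@[_]](coef_map ev) -/g g0 coef0.
have [t gt_neq0] : exists t : nat, g.[t%:R] != 0.
  apply/not_existsP => g_roots.
  have : (size [seq i%:R : K | i <- iota 0 (size g)] < size g)%N.
    apply: max_poly_roots g_neq0 _ _.
      by apply/allP => _ /mapP[i _ ->]; apply/negbNE/negP/g_roots.
    rewrite map_inj_uniq ?iota_uniq // => i j /eqP.
    by rewrite eqr_nat // => /eqP.
  by rewrite size_map size_iota ltnn.
exists (fun i => if unlift ord_max i is Some j then v' j else t).
suff -> : f.@[fun i => (if unlift ord_max i is Some j then v' j else t)%:R]
  = g.[t%:R] by [].
rewrite /g muniE [f in LHS]mpolyE !raddf_sum /= -horner_evalE raddf_sum.
apply: eq_bigr => m _ /=.
rewrite mevalZ mevalX map_polyZ /= map_polyXn horner_evalE hornerZ hornerXn.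
rewrite big_ord_recr /= unlift_none mevalZ mevalX -mulrA.
congr (_ * (_ * _)); apply: eq_bigr => i _; rewrite mnmE.
have -> : widen_ord (leqnSn n) i = lift ord_max i.
  by apply/val_inj; rewrite /= /bump leqNgt ltn_ord.
by rewrite liftK.
Qed.

(** * Veronese subrings *)

Section WeightedVeronese.
Variables (K : fieldType) (n : nat) (mf : measure n) (k : nat).

Definition veronese_pred : pred {mpoly K[n]} :=
  fun p => all (fun m => k %| mf m)%N (msupp p).

Lemma veroneseP p : reflect {in msupp p, forall m, (k %| mf m)%N} (veronese_pred p).
Proof. exact: allP. Qed.

Lemma veronese_subring : subring_closed veronese_pred.
Proof.
split=> [|p q /veroneseP vp /veroneseP vq|p q /veroneseP vp /veroneseP vq].
- by apply/veroneseP => m; rewrite msupp1 inE => /eqP->; rewrite mf0 dvdn0.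
- by apply/veroneseP => m /msuppB_le; rewrite mem_cat => /orP[/vp|/vq].
apply/veroneseP => _ /msuppM_le /allpairsP[[m1 m2] /= [/vp d1 /vq d2 ->]].
by rewrite mfD dvdn_add.
Qed.

HB.instance Definition _ :=
  GRing.isSubringClosed.Build {mpoly K[n]} veronese_pred veronese_subring.

(** The part of [q] outside the subring has a product with [p] that is both in
    the subring and supported outside it, hence zero. *)
Lemma veronese_quotient p q :
  p != 0 -> p \in veronese_pred -> p * q \in veronese_pred -> q \in veronese_pred.
Proof.
move=> p_neq0 vp vpq.
(* [part P] is the part of [q] supported by the monomials satisfying [P]. *)
pose part (P : pred 'X_{1..n}) := \sum_(m <- msupp q | P m) q@_m *: 'X_[m].
have part_supp P : {in msupp (part P), forall m, P m}.
  move=> m /msupp_sum_le /flatten_mapP[m']; rewrite mem_filter => /andP[Pm' _].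
  by move=> /msuppZ_le; rewrite msuppX inE => /eqP->.
pose in_k m := (k %| mf m)%N.
have eq_q : q = part in_k + part (predC in_k) by rewrite {1}[q]mpolyE (bigID in_k).
have v1 : part in_k \in veronese_pred by apply/veroneseP/part_supp.
suff out0 : p * part (predC in_k) = 0.
  move/eqP: out0; rewrite mulf_eq0 (negbTE p_neq0) /= => /eqP out0.
  by rewrite eq_q out0 addr0.
have v2 : p * part (predC in_k) \in veronese_pred.
  have -> : p * part (predC in_k) = p * q - p * part in_k.
    by rewrite [in RHS]eq_q mulrDr addrAC subrr add0r.
  by rewrite rpredB // rpredM.
apply: msuppnil0; apply/eqP; rewrite -size_eq0 -all_pred0; apply/allP => m m_in.
have /msuppM_le /allpairsP[[m1 m2] /= [m1_in m2_in eq_m]] := m_in.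
have := part_supp _ _ m2_in; rewrite /= /in_k => /negP nk; case: nk.
have := veroneseP _ v2 _ m_in.
by rewrite eq_m mfD dvdn_addr //; apply: (veroneseP _ vp).
Qed.

Lemma veronese_divring : divring_closed veronese_pred.
Proof.
split; [exact: rpred1 | exact: rpredB |] => p q vp vq.
have [q_unit|/invr_out->] := boolP (q \is a GRing.unit); last exact: rpredM.
apply: (veronese_quotient _ vq); last by rewrite mulrCA divrr // mulr1.
by apply: contraTneq q_unit => ->; rewrite unitr0.
Qed.

HB.instance Definition _ :=
  GRing.isDivringClosed.Build {mpoly K[n]} veronese_pred veronese_divring.

(** The Veronese subring as an integral domain in its own right; it serves as
    the coordinate ring of the cone. *)
Record veronese := Veronese {
  veronese_val : {mpoly K[n]};
  veronese_valP : veronese_val \in veronese_pred }.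

HB.instance Definition _ := [isSub for veronese_val].
HB.instance Definition _ := [Choice of veronese by <:].
HB.instance Definition _ := [SubChoice_isSubIntegralDomain of veronese by <:].

End WeightedVeronese.

(** If [x = a / b] is a root of a monic polynomial of degree [n], then [b ^+ n]
    is a common denominator of all powers of [x], because each power is a
    combination of the first [n] ones.  So [x] lies in [S], and then in [A] by
    the last hypothesis. *)
Lemma integrally_closed_subring (A S : idomainType) (iota : {rmorphism A -> S}) :
  injective iota -> completely_integrally_closed S ->
  (forall (a b : A) (h : S),
     b != 0 -> iota a = h * iota b -> exists h', h = iota h') ->
  integrally_closed A.
Proof.
move=> iota_inj cicS quotA x [p p_monic /rootP px0].
have [a [b [b_neq0 eq_xb]]] := fraction_repr x.
have iota_b : iota b != 0 by rewrite -(rmorph0 iota) (inj_eq iota_inj).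
have [n sz_p] : exists n, size p = n.+1.
  by exists (size p).-1; rewrite prednK // size_poly_gt0 monic_neq0.
have xn : x ^+ n = - \sum_(i < n) tofrac p`_i * x ^+ i.
  move: px0; rewrite horner_coef size_map_inj_poly ?sz_p ?rmorph0 //; last first.
    exact: tofrac_inj.
  rewrite big_ord_recr /= [X in _ + X](_ : _ = x ^+ n); last first.
    move/monicP: p_monic; rewrite lead_coefE sz_p /= => p_n.
    by rewrite coef_map /= p_n rmorph1 mul1r.
  move=> /eqP; rewrite addrC addr_eq0 => /eqP->; congr (- _).
  by apply: eq_bigr => i _; rewrite coef_map.
have almost j : exists e, tofrac (b ^+ n) * x ^+ j = tofrac e.
  elim/ltn_ind: j => j IHj; have [lt_jn|le_nj] := ltnP j n.
    exists (b ^+ (n - j) * a ^+ j).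
    rewrite -[in LHS](subnK (ltnW lt_jn)) exprD !rmorphM !rmorphXn /= -mulrA.
    by rewrite -exprMn mulrC [_ * x]mulrC eq_xb mulrC.
  have /choice[e eq_e] (i : 'I_n) :
      exists e, tofrac (b ^+ n) * x ^+ (i + (j - n)) = tofrac e.
    by apply: IHj; rewrite -[X in (_ < X)%N](subnKC le_nj) ltn_add2r.
  exists (- \sum_(i < n) p`_i * e i).
  rewrite -[in LHS](subnKC le_nj) exprD xn rmorphN rmorph_sum /= mulNr mulrN; congr (- _).
  rewrite mulr_suml mulr_sumr; apply: eq_bigr => i _.
  by rewrite rmorphM /= -eq_e exprD !mulrA; congr (_ * _ * _); rewrite mulrC.
have [h eq_h] : exists h, iota a = h * iota b.
  apply: (cicS (iota b ^+ n)) => // [|j]; first exact: expf_neq0.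
  have [e eq_e] := almost j; exists (iota e).
  rewrite -!rmorphXn -!rmorphM; congr (iota _); apply: tofrac_inj.
  by rewrite !rmorphM /= -eq_e !rmorphXn /= -eq_xb exprMn mulrA.
have [h' eq_h'] := quotA _ _ _ b_neq0 eq_h.
exists h'; apply: (@mulIf _ (tofrac b)); first by rewrite tofrac_eq0.
rewrite eq_xb -rmorphM; congr tofrac; apply: iota_inj.
by rewrite eq_h eq_h' rmorphM.
Qed.

Lemma veronese_integrally_closed (K : fieldType) n (mf : measure n) k :
  integrally_closed (veronese K mf k).
Proof.
apply: (integrally_closed_subring (iota := val)) => [||a b h b_neq0 eq_h].
- exact: val_inj.
- exact: completely_integrally_closed_mpoly.
have vh : h \in @veronese_pred K n mf k.
  apply: (@veronese_quotient _ _ _ _ (val b)); last by rewrite mulrC -eq_h (valP a).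
    by move: b_neq0; rewrite -(inj_eq val_inj) rmorph0.
  exact: (valP b).
by exists (Veronese vh).
Qed.

(** * Shuffles and group-like elements *)

Section Shuffle.
Variable T : Type.

Fixpoint shuffle (u : seq T) : seq T -> seq (seq T) :=
  fix shuffle_u (v : seq T) :=
    match u, v with
    | [::], _ => [:: v]
    | _, [::] => [:: u]
    | a :: u', b :: v' =>
        [seq a :: w | w <- shuffle u' v] ++ [seq b :: w | w <- shuffle_u v']
    end.

Lemma shuffle0s v : shuffle [::] v = [:: v]. Proof. by case: v. Qed.

Lemma shuffles0 u : shuffle u [::] = [:: u]. Proof. by case: u. Qed.

Lemma shuffle_cons a u b v :
  shuffle (a :: u) (b :: v) =
    [seq a :: w | w <- shuffle u (b :: v)] ++
    [seq b :: w | w <- shuffle (a :: u) v].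
Proof. by []. Qed.
End Shuffle.

Lemma size_shuffle (T : eqType) (u v w : seq T) :
  w \in shuffle u v -> size w = (size u + size v)%N.
Proof.
elim: u v w => [|a u IHu] v w; first by rewrite shuffle0s inE => /eqP->.
elim: v w => [|b v IHv] w; first by rewrite shuffles0 inE addn0 => /eqP->.
rewrite shuffle_cons mem_cat => /orP[] /mapP[w' w'_in ->] /=.
  by rewrite (IHu _ _ w'_in).
by rewrite (IHv _ w'_in) /= addSn addnS.
Qed.

(* Keeps simplification from exposing the iteration behind powers. *)
Local Arguments ncpow : simpl never.

Section Coproduct.
Variables (K : comNzRingType) (d : nat).
Implicit Types (f g : ncseries K d) (u v w : seq 'I_d).

(** The coproduct of the free algebra that makes the letters primitive, on
    coefficients: the coefficient of [u] tensor [v] in the image of [f] is the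
    sum of the coefficients of [f] over the shuffles of [u] and [v]. *)
Definition coprod f u v := \sum_(w <- shuffle u v) f w.

Definition lderiv (a : 'I_d) f : ncseries K d := fun w => f (a :: w).

Lemma coprod0s f v : coprod f [::] v = f v.
Proof. by rewrite /coprod shuffle0s big_seq1. Qed.

Lemma coprods0 f u : coprod f u [::] = f u.
Proof. by rewrite /coprod shuffles0 big_seq1. Qed.

Lemma coprod_cons f a u b v :
  coprod f (a :: u) (b :: v) =
    coprod (lderiv a f) u (b :: v) + coprod (lderiv b f) (a :: u) v.
Proof. by rewrite /coprod shuffle_cons big_cat !big_map. Qed.

Lemma coprod_lin c f g u v :
  coprod (fun w => c * f w + g w) u v = c * coprod f u v + coprod g u v.
Proof. by rewrite /coprod big_split mulr_sumr. Qed.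

Lemma ncmul_cons f g a w :
  ncmul f g (a :: w) = f [::] * g (a :: w) + ncmul (lderiv a f) g w.
Proof. by rewrite /ncmul /= big_ord_recl. Qed.

Lemma coprod_lderiv_mul f g a u v :
  coprod (lderiv a (ncmul f g)) u v =
    f [::] * coprod (lderiv a g) u v + coprod (ncmul (lderiv a f) g) u v.
Proof.
by rewrite -coprod_lin /coprod; apply: eq_bigr => w _; rewrite /lderiv ncmul_cons.
Qed.

(** The coproduct is a morphism of algebras.  Both sides satisfy the same
    recursion on the first letters: the left derivatives by a letter act on a
    product by [ncmul_cons], on a coproduct by [coprod_cons]. *)
Lemma coprod_mul f g u v :
  coprod (ncmul f g) u v =
    \sum_(i < (size u).+1) \sum_(j < (size v).+1)
       coprod f (take i u) (take j v) * coprod g (drop i u) (drop j v).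
Proof.
elim: u v f => [|a u IHu] v f.
  rewrite big_ord1 coprod0s; apply: eq_bigr => j _.
  by rewrite /= !coprod0s.
elim: v f => [|b v IHv] f.
  rewrite coprods0; apply: eq_bigr => i _.
  by rewrite big_ord1 !coprods0.
rewrite coprod_cons !coprod_lderiv_mul IHu IHv addrACA -mulrDr -coprod_cons.
rewrite [in RHS]big_ord_recl [in RHS]big_ord_recl /= coprod0s -!addrA.
congr (_ + _).
rewrite [X in _ + X]big_ord_recl /= addrCA; congr (_ + _).
  by apply: eq_bigr => j _; rewrite !coprod0s.
rewrite -big_split; apply: eq_bigr => i _ /=.
rewrite big_ord_recl [in RHS]big_ord_recl /= !coprods0 -addrA; congr (_ + _).
rewrite -big_split; apply: eq_bigr => j _ /=.
by rewrite coprod_cons mulrDl.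
Qed.

Definition primitive f :=
  f [::] = 0 /\ forall u v, (0 < size u)%N -> (0 < size v)%N -> coprod f u v = 0.

Lemma coprod_primitive_mul f g u v : primitive f ->
  coprod (ncmul f g) u v =
    \sum_(i < (size u).+1) f (take i u) * coprod g (drop i u) v
    + \sum_(j < (size v).+1) f (take j v) * coprod g u (drop j v).
Proof.
case=> f0 f_prim; rewrite coprod_mul.
rewrite (eq_bigr (fun i : 'I_(size u).+1 =>
  f (take i u) * coprod g (drop i u) v +
  \sum_(j < size v)
     coprod f (take i u) (take j.+1 v) * coprod g (drop i u) (drop j.+1 v)));
  last first.
  by move=> i _; rewrite big_ord_recl take0 drop0 coprods0.
rewrite big_split /=; congr (_ + _).
rewrite big_ord_recl [X in _ + X]big1 ?addr0; last first.
  move=> i _; rewrite big1 // => j _; rewrite f_prim ?mul0r //.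
    by have -> : size (take (lift ord0 i) u) = i.+1 := size_takel (ltn_ord i).
  by rewrite size_takel.
rewrite [RHS]big_ord_recl /= !take0 !drop0 f0 mul0r add0r.
by apply: eq_bigr => j _; rewrite coprod0s.
Qed.

(** In the coproduct of [f * g] the cross terms are
    [f u * g v + f v * g u], which is symmetric in [f] and [g]. *)
Lemma primitive_bracket f g : primitive f -> primitive g -> primitive (ncbracket f g).
Proof.
have coprod_prim2 f1 f2 u v : primitive f1 -> primitive f2 ->
    (0 < size u)%N -> (0 < size v)%N ->
    coprod (ncmul f1 f2) u v = f1 u * f2 v + f1 v * f2 u.
  move=> prim1 [f20 prim2] u_gt0 v_gt0; rewrite coprod_primitive_mul //.
  rewrite !big_ord_recr /= !take_size !drop_size coprod0s coprods0.
  rewrite !big1 ?add0r // => i _; rewrite prim2 ?mulr0 //.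
    by rewrite size_drop subn_gt0.
  by rewrite size_drop subn_gt0.
move=> prim_f prim_g; split=> [|u v u_gt0 v_gt0].
  by rewrite /ncbracket /ncmul !big_ord1 /= prim_f.1 prim_g.1 mulr0 subr0.
rewrite /ncbracket /coprod sumrB -!/(coprod _ _ _) !coprod_prim2 //.
by rewrite [g u * _]mulrC [g v * _]mulrC [X in _ - X]addrC subrr.
Qed.

Lemma primitive_lin c f g : primitive f -> primitive g ->
  primitive (fun w => c * f w + g w).
Proof.
move=> [f0 pf] [g0 pg]; split=> [|u v u_gt0 v_gt0]; first by rewrite f0 g0 mulr0 addr0.
by rewrite coprod_lin pf // pg // mulr0 addr0.
Qed.

Lemma primitive0 : primitive (fun=> 0).
Proof. by split=> // u v _ _; rewrite /coprod big1. Qed.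

Lemma primitive_var a : primitive (ncvar K a).
Proof.
split=> // u v u_gt0 v_gt0; rewrite /coprod big_seq big1 // => w /size_shuffle sz_w.
rewrite /ncvar; case: eqP => // eq_w; move: sz_w; rewrite eq_w /=.
by case: u u_gt0 => // ? ?; case: v v_gt0 => // ? ?; rewrite addSn addnS.
Qed.

Lemma primitive_lie f : lie K d f -> primitive f.
Proof.
move=> lie_f; apply: (_ : (lie K d `<=` [set h | primitive h])%classic) lie_f.
apply: smallest_sub => [|_ [i _ <-]]; last exact: primitive_var.
split; last by move=> f1 f2; apply: primitive_bracket.
by split=> [|c f1 f2]; [exact: primitive0 | exact: primitive_lin].
Qed.

Lemma ncpowS f n : ncpow f n.+1 = ncmul f (ncpow f n).
Proof. by []. Qed.

(** The binomial formula for [f] tensor 1 + 1 tensor [f], whose two terms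
    commute. *)
Lemma coprod_pow f n u v : primitive f ->
  coprod (ncpow f n) u v =
    \sum_(i < n.+1) (ncpow f i u * ncpow f (n - i) v) *+ 'C(n, i).
Proof.
move=> prim_f; elim: n u v => [|n IHn] u v.
  rewrite big_ord1 bin0 mulr1n /coprod /ncpow /= /nc1.
  case: u => [|a u]; first by rewrite shuffle0s big_seq1 mul1r.
  rewrite mul0r big_seq big1 // => w /size_shuffle.
  by case: w.
rewrite ncpowS coprod_primitive_mul //.
have eq1 : \sum_(i < (size u).+1) f (take i u) * coprod (ncpow f n) (drop i u) v =
    \sum_(l < n.+1) (ncpow f l.+1 u * ncpow f (n - l) v) *+ 'C(n, l).
  under eq_bigr do rewrite IHn mulr_sumr.
  rewrite exchange_big; apply: eq_bigr => l _ /=.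
  rewrite ncpowS /ncmul mulr_suml -sumrMnl.
  by apply: eq_bigr => i _; rewrite mulrnAr mulrA.
have eq2 : \sum_(j < (size v).+1) f (take j v) * coprod (ncpow f n) u (drop j v) =
    \sum_(l < n.+1) (ncpow f l u * ncpow f (n - l).+1 v) *+ 'C(n, l).
  under eq_bigr do rewrite IHn mulr_sumr.
  rewrite exchange_big; apply: eq_bigr => l _ /=.
  rewrite ncpowS /ncmul mulr_sumr -sumrMnl.
  by apply: eq_bigr => i _; rewrite mulrnAr mulrCA.
rewrite eq1 eq2 [in RHS]big_ord_recl /= subn0 bin0 mulr1n.
under [in RHS]eq_bigr do rewrite /bump /= add1n binS mulrnDr subSS.
rewrite big_split /= addrA [RHS]addrC; congr (_ + _).
rewrite big_ord_recl [in RHS]big_ord_recr /= (bin_small (ltnSn n)) mulr0n addr0.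
rewrite subn0 bin0 mulr1n; congr (_ + _).
apply: eq_bigr => l _; rewrite /bump /= add1n; congr (_ * _ *+ _).
by rewrite subnSK.
Qed.

End Coproduct.

Section Exponential.
Variables (F : numFieldType) (S : comAlgType F) (d : nat).
Implicit Types (f : ncseries S d) (u v w : seq 'I_d).

(** The exponential of a series with coefficients in an algebra over a field;
    applied to polynomials, it yields the coefficients of [exp L] as functions
    of the coordinates of [L]. *)
Definition algexp f : ncseries S d :=
  fun w => \sum_(n < (size w).+1) (n`!%:R)^-1 *: ncpow f n w.

(** The exponential of a primitive element is group-like.  The double sum over
    the powers of [f] at [u] and at [v] is reorganized by total exponent, by
    viewing its two factors as values at 1 of univariate polynomials. *)
Lemma algexp_shuffle f u v : primitive f ->
  algexp f u * algexp f v = \sum_(w <- shuffle u v) algexp f w.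
Proof.
move=> prim_f.
pose e w n := (n`!%:R^-1 : F) *: ncpow f n w.
have expE w : algexp f w = (\poly_(n < (size w).+1) e w n).[1].
  rewrite (horner_coef_wide _ (size_poly _ _)); apply: eq_bigr => n _.
  by rewrite expr1n mulr1 coef_poly ltn_ord.
have coefE w n : (\poly_(n < (size w).+1) e w n)`_n = e w n.
  rewrite coef_poly ltnS; case: leqP => // lt_wn.
  by rewrite /e ncpow_eq0 ?prim_f.1 ?scaler0.
rewrite !expE -hornerM (@horner_coef_wide _ (size u + size v).+1); last first.
  apply: leq_trans (size_polyMleq _ _) _; rewrite -subn1 leq_subLR add1n.
  by rewrite -addSn -addnS leq_add // size_poly.
rewrite [RHS]big_seq.
rewrite [RHS](eq_bigr (fun w => \sum_(n < (size u + size v).+1) e w n));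
  last first.
  by move=> w w_in; rewrite /algexp (size_shuffle w_in).
rewrite -[RHS]big_seq [RHS]exchange_big; apply: eq_bigr => n _ /=.
rewrite expr1n mulr1 coefM -scaler_sumr -/(coprod _ _ _) coprod_pow // scaler_sumr.
apply: eq_bigr => i _; rewrite !coefE /e -scalerAl -scalerAr scalerA.
rewrite -scaler_nat scalerA; congr (_ *: _).
have le_in : (i <= n)%N by rewrite -ltnS.
have nz j : (j`!%:R : F) != 0 by rewrite pnatr_eq0 -lt0n fact_gt0.
apply: (mulfI (nz n)); rewrite [RHS]mulrA [in RHS]mulfV // mul1r -(bin_fact le_in).
rewrite !natrM -[LHS]mulrA [X in _ * X](_ : _ = 1) ?mulr1 //.
by rewrite mulrACA !mulfV // mulr1.
Qed.
End Exponential.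

(** * A homogeneous basis of the truncated Lie algebra *)

Section GradedLie.
Variables (K : comNzRingType) (d : nat).
Implicit Types (f g : ncseries K d) (w : seq 'I_d).

Definition nccomp (i : nat) f : ncseries K d :=
  fun w => if size w == i then f w else 0.

Lemma lie_lin c f g : lie K d f -> lie K d g -> lie K d (fun w => c * f w + g w).
Proof. by move=> lf lg V [lieV sV]; apply: lieV.1.2; [apply: lf | apply: lg]. Qed.

Lemma lie0 : lie K d (fun=> 0).
Proof. by move=> V [lieV sV]; apply: lieV.1.1. Qed.

Lemma lie_ncbracket f g : lie K d f -> lie K d g -> lie K d (ncbracket f g).
Proof. by move=> lf lg V [lieV sV]; apply: lieV.2; [apply: lf | apply: lg]. Qed.

Lemma lie_sum (I : Type) (r : seq I) (c : I -> K) (F : I -> ncseries K d) :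
  (forall i, lie K d (F i)) -> lie K d (fun w => \sum_(i <- r) c i * F i w).
Proof.
move=> lieF; elim: r => [|i r IHr].
  rewrite (_ : (fun=> _) = fun=> 0); first exact: lie0.
  by apply/funext=> w; rewrite big_nil.
rewrite (_ : (fun=> _) = fun w => c i * F i w + \sum_(j <- r) c j * F j w).
  exact: lie_lin.
by apply/funext=> w; rewrite big_cons.
Qed.

Lemma nccomp_mul n f g w :
  nccomp n (ncmul f g) w = \sum_(i < n.+1) ncmul (nccomp i f) (nccomp (n - i) g) w.
Proof.
rewrite /nccomp; case: eqP => [sz_w|neq_n].
  rewrite /ncmul exchange_big /= sz_w; apply: eq_bigr => j _.
  have le_j : (j <= size w)%N by rewrite sz_w -ltnS.
  rewrite (bigD1 j) //= size_takel // size_drop sz_w !eqxx big1 ?addr0 // => i neq_ij.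
  case: (eqVneq (j : nat) i) => [/val_inj eq_ji|_]; last by rewrite mul0r.
  by rewrite eq_ji eqxx in neq_ij.
rewrite big1 // => i _; rewrite /ncmul big1 // => j _.
have le_j : (j <= size w)%N by rewrite -ltnS.
rewrite size_takel // size_drop; case: eqP => [eq_ji|_]; last by rewrite mul0r.
case: eqP => [eq_sz|_]; last by rewrite mulr0.
case: neq_n; rewrite -(subnKC le_j) eq_sz eq_ji subnKC //; by rewrite -ltnS.
Qed.

(** The Lie algebra is graded: the series all of whose homogeneous components
    are Lie form a Lie subspace containing the letters. *)
Lemma lie_nccomp n f : lie K d f -> lie K d (nccomp n f).
Proof.
move=> lie_f; move: n.
apply: (_ : (lie K d `<=` [set h | forall n, lie K d (nccomp n h)])%classic) lie_f.
apply: smallest_sub => [|_ [i _ <-] n] /=; last first.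
  have [eq_n|neq_n] := eqVneq n 1%N.
    rewrite (_ : nccomp n _ = ncvar K i).
      by move=> V [_ sV]; apply: sV; exists i.
    apply/funext=> w; rewrite /nccomp eq_n /ncvar.
    by case: eqP => // neq1; case: eqP => // eq_w; rewrite eq_w in neq1.
  rewrite (_ : nccomp n _ = fun=> 0); first exact: lie0.
  apply/funext=> w; rewrite /nccomp /ncvar; case: eqP => // eq_w.
  by case: eqP => // eq_wi; move: neq_n; rewrite -eq_w eq_wi eqxx.
split; [split=> [n|c f1 f2 l1 l2 n]|move=> f1 f2 l1 l2 n] => /=.
- rewrite (_ : nccomp n _ = fun=> 0); first exact: lie0.
  by apply/funext=> w; rewrite /nccomp; case: eqP.
- rewrite (_ : nccomp n _ = fun w => c * nccomp n f1 w + nccomp n f2 w).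
    exact: lie_lin.
  by apply/funext=> w; rewrite /nccomp; case: eqP; rewrite ?mulr0 ?addr0.
rewrite (_ : nccomp n _ = fun w => \sum_(i < n.+1)
    1 * ncbracket (nccomp i f1) (nccomp (n - i) f2) w).
  by apply: lie_sum => i; apply: lie_ncbracket.
apply/funext=> w; rewrite /ncbracket.
under eq_bigr do rewrite mul1r.
rewrite big_split /= sumrN -nccomp_mul.
(* In the second product the degrees of the two factors are exchanged. *)
rewrite [X in _ - X](reindex_inj rev_ord_inj) /=.
under [X in _ - X]eq_bigr => i _ do rewrite subSS subKn -1?ltnS //.
by rewrite -nccomp_mul /nccomp; case: eqP => // _; rewrite subr0.
Qed.

End GradedLie.

(** As [H] is any set of vectors, a basis of a graded space can be chosen among
    its homogeneous elements. *)
Lemma max_row_free (K : fieldType) n (H : 'rV[K]_n -> Prop) :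
  exists N (B : 'M[K]_(N, n)), [/\ row_free B, forall i, H (row i B) &
    forall x, H x -> (x <= B)%MS].
Proof.
pose P N := `[< exists B : 'M[K]_(N, n), row_free B /\ forall i, H (row i B) >].
have exP : exists N, P N.
  by exists 0%N; apply/asboolP; exists 0; split; [rewrite /row_free mxrank0 | case].
have P_le N : P N -> (N <= n)%N.
  by move=> /asboolP[B [/eqP rkB _]]; rewrite -rkB rank_leq_col.
case: (ex_maxnP exP P_le) => N /asboolP[B [freeB HB]] maxN.
exists N, B; split=> // x Hx; apply/negPn/negP => x_out.
suff /maxN : P (1 + N)%N by rewrite ltnn.
apply/asboolP; exists (col_mx x B); split; last first.
  move=> i; case: (splitP i) => j eq_ij.
    rewrite (_ : i = lshift N j) ?rowKu; last exact/val_inj.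
    by rewrite (_ : row j x = x) //; apply/rowP => l; rewrite mxE ord1.
  by rewrite (_ : i = rshift 1 j) ?rowKd; [exact: HB | apply/val_inj].
have ltB : (B < x + B)%MS.
  rewrite ltmxE addsmxSr /=; apply: contra x_out => /(submx_trans _); apply.
  exact: addsmxSl.
rewrite /row_free eqn_leq rank_leq_row /= -addsmxE addnC addn1.
by move/eqP: freeB => {1}<-; apply: rank_ltmx.
Qed.

(** A maximal free family among the homogeneous components of Lie elements, seen
    as vectors indexed by the words of length at most [m], is a basis because
    truncated Lie elements are sums of such components.  The family [D] is a
    dual basis, obtained from a right inverse of the matrix of [b]; as [b j] is
    homogeneous, only the words of its degree contribute to the pairing. *)
Lemma homogeneous_lie_basis (K : fieldType) (d m : nat) :
  exists (N : nat) (wt : 'I_N -> nat) (b : 'I_N -> ncseries K d)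
         (D : seq 'I_d -> 'I_N -> K),
  [/\ forall j, (0 < wt j <= m)%N,
      forall j w, size w != wt j -> b j w = 0,
      forall j, lie K d (b j),
      forall L, lie_trunc K d m L <->
        exists t, L = fun w => \sum_j t j * b j w &
      forall i j, \sum_(w : m.-bseq 'I_d | size w == wt i) D w i * b j w
        = (j == i)%:R].
Proof.
pose vec (f : ncseries K d) : 'rV[K]_(#|{: m.-bseq 'I_d}|) :=
  \row_j f (enum_val j : m.-bseq 'I_d).
pose H x := exists e : nat * ncseries K d,
  [/\ (0 < e.1 <= m)%N, lie K d e.2 & x = vec (nccomp e.1 e.2)].
have [N [B [freeB HB maxB]]] := max_row_free H.
have /choice[e eP] := HB.
pose wt j := (e j).1; pose b j := nccomp (wt j) (e j).2.
have vecb j : vec (b j) = row j B by have [_ _ ->] := eP j.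
have wtP j : (0 < wt j <= m)%N by have [] := eP j.
have b0 j w : size w != wt j -> b j w = 0.
  by move=> neq; rewrite /b /nccomp (negbTE neq).
have bL j : lie K d (b j) by have [_ lj _] := eP j; apply: lie_nccomp.
have /row_freeP[B' BB'] := freeB.
have vecE f (w : m.-bseq 'I_d) : vec f 0 (enum_rank w) = f w.
  by rewrite mxE enum_rankK.
(* The dual family, extended by 0 to the words longer than [m]. *)
pose D (w : seq 'I_d) i : K :=
  if insub w is Some w' then B' (enum_rank (w' : m.-bseq 'I_d)) i else 0.
have DE (w : m.-bseq 'I_d) i : D w i = B' (enum_rank w) i by rewrite /D valK.
have dual i j : \sum_(w : m.-bseq 'I_d) D w i * b j w = (j == i)%:R.
  have := congr1 (fun M : 'M_N => M j i) BB'; rewrite !mxE => <-.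
  rewrite [RHS](reindex (@enum_rank _)) /=; last exact/onW_bij/enum_rank_bij.
  apply: eq_bigr => w _; rewrite DE mulrC; congr (_ * _).
  by rewrite -vecE vecb mxE.
exists N, wt, b, D; split=> // [L|i j]; last first.
  have [eq_wt|neq_wt] := eqVneq (wt j) (wt i).
    rewrite -dual [RHS](bigID (fun w : m.-bseq 'I_d => size w == wt i)) /=.
    rewrite [X in _ = _ + X]big1 ?addr0 // => w neq_w.
    by rewrite b0 ?mulr0 // eq_wt.
  rewrite big1 => [|w /eqP sz_w]; last by rewrite b0 ?mulr0 // sz_w eq_sym.
  by case: eqVneq => // eq_ji; rewrite eq_ji eqxx in neq_wt.
have b_trunc j w : (m < size w)%N -> b j w = 0.
  move=> lt_mw; apply: b0; rewrite gtn_eqF //; apply: leq_ltn_trans lt_mw.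
  by case/andP: (wtP j).
split=> [[f lie_f <-]|[t ->]]; last first.
  exists (fun w => \sum_j t j * b j w); first exact: lie_sum.
  apply/funext=> w; rewrite /nctrunc; case: leqP => // lt_mw.
  by rewrite big1 // => j _; rewrite b_trunc ?mulr0.
have vec_sum : vec (nctrunc m f) = \sum_(i < m.+1) vec (nccomp i f).
  apply/rowP=> l; rewrite summxE mxE /nctrunc size_bseq.
  set w := enum_val l.
  have lt_w : (size (w : m.-bseq _) < m.+1)%N by rewrite ltnS size_bseq.
  rewrite (bigD1 (Ordinal lt_w)) //= mxE /nccomp eqxx big1 ?addr0 // => i neq_i.
  by rewrite mxE ifN // -[size _]/(val (Ordinal lt_w)) val_eqE eq_sym.
have /submxP[t eq_t] : (vec (nctrunc m f) <= B)%MS.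
  rewrite vec_sum; apply: summx_sub => i _; have [i0|i_gt0] := posnP i.
    rewrite (_ : vec _ = 0) ?sub0mx //; apply/rowP=> l; rewrite !mxE /nccomp i0.
    by case: eqP => // /size0nil->; exact: lie_const0.
  by apply: maxB; exists (val i, f); split=> //; rewrite /= i_gt0 -ltnS /=.
exists (t 0); apply/funext=> w.
have [le_wm|lt_mw] := leqP (size w) m; last first.
  rewrite /nctrunc leqNgt lt_mw big1 // => j _.
  by rewrite b_trunc ?mulr0.
have := congr1 (fun r : 'rV_ _ => r 0 (enum_rank (Bseq le_wm))) eq_t.
rewrite vecE => ->; rewrite mxE; apply: eq_bigr => j _; congr (_ * _).
by have := vecE (b j) (Bseq le_wm); rewrite vecb mxE.
Qed.

(** * Weighted degrees of monomials *)

Definition weight n (wt : 'I_n -> nat) (m : 'X_{1..n}) : nat :=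
  (\sum_i m i * wt i)%N.

Section Weight.
Variables (n : nat) (wt : 'I_n -> nat).

Lemma weight0 : weight wt 0%MM = 0%N.
Proof. by rewrite /weight big1 // => i _; rewrite mnm0E mul0n. Qed.

Lemma weightD : {morph weight wt : m1 m2 / (m1 + m2)%MM >-> (m1 + m2)%N}.
Proof.
move=> m1 m2; rewrite /weight -big_split; apply: eq_bigr => i _ /=.
by rewrite mnmDE mulnDl.
Qed.

HB.instance Definition _ := isMeasure.Build n (weight wt) weight0 weightD.

Lemma weight1 i : weight wt U_(i)%MM = wt i.
Proof.
rewrite /weight (bigD1 i) //= mnm1E eqxx mul1n big1 ?addn0 // => j neq_ji.
by rewrite mnm1E eq_sym (negbTE neq_ji) mul0n.
Qed.

Lemma weight_sum (I : Type) (r : seq I) (P : pred I) (F : I -> 'X_{1..n}) :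
  weight wt (\sum_(i <- r | P i) F i)%MM = (\sum_(i <- r | P i) weight wt (F i))%N.
Proof. exact: (big_morph _ weightD weight0). Qed.

Lemma weight_eq0 m : (forall i, (0 < wt i)%N) -> (weight wt m == 0%N) = (m == 0%MM).
Proof.
move=> wt_gt0; apply/idP/eqP=> [|->]; last by rewrite weight0.
rewrite /weight sum_nat_eq0 => /forallP m0; apply/mnmP=> i; rewrite mnm0E.
have := m0 i; rewrite muln_eq0 [wt i == 0%N]eqn0Ngt wt_gt0 orbF.
by move=> /eqP.
Qed.

Lemma multinom_sum (m : 'X_{1..n}) :
  exists s : seq 'I_n, m = (\sum_(i <- s) U_(i))%MM.
Proof.
exists (flatten [seq nseq (m i) i | i <- enum 'I_n]).
rewrite {1}[m]multinomUE_id big_flatten big_map big_enum /=.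
apply: eq_bigr => i _; rewrite big_nseq; elim: (m i) => // l IHl.
by rewrite mulmS iterS -IHl.
Qed.

Lemma exists_submonomial (m k : nat) (mu : 'X_{1..n}) :
  (0 < k)%N -> (forall j, (1 <= j <= m)%N -> (j %| k)%N) ->
  (forall i, (0 < wt i <= m)%N) -> mu != 0%MM -> (k %| weight wt mu)%N ->
  exists mu1 mu2, mu = (mu1 + mu2)%MM /\ weight wt mu1 = k.
Proof.
move=> k_gt0 dvd_k wt_bd mu_neq0 dvd_mu.
have wt_gt0 i : (0 < wt i)%N by case/andP: (wt_bd i).
have [s eq_mu] := multinom_sum mu.
pose w (i : 'I_(size s)) := wt (tnth (in_tuple s) i).
have eq_w : weight wt mu = (\sum_i w i)%N.
  rewrite eq_mu weight_sum big_tnth; apply: eq_bigr => i _; exact: weight1.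
have [||J sumJ] := exists_subset_sum (w := w) k_gt0 dvd_k (fun i => wt_bd _).
- by rewrite -eq_w.
- by rewrite -eq_w lt0n weight_eq0.
exists (\sum_(i in J) U_(tnth (in_tuple s) i))%MM.
exists (\sum_(i in ~: J) U_(tnth (in_tuple s) i))%MM; split.
  rewrite {1}eq_mu big_tnth (bigID (mem J)) /=; congr (_ + _)%MM.
  by apply: eq_bigl => i; rewrite inE.
by rewrite weight_sum -[RHS]sumJ; apply: eq_bigr => i _; apply: weight1.
Qed.

End Weight.

(** * Coefficients of the exponential of a generic Lie element *)

Section Coordinates.
Variables (F : numFieldType) (d m N : nat).
Variables (wt : 'I_N -> nat) (b : 'I_N -> ncseries F d).
Variable D : seq 'I_d -> 'I_N -> F.
Hypothesis wt_gt0 : forall j, (0 < wt j)%N.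
Hypothesis b_homog : forall j w, size w != wt j -> b j w = 0.
Hypothesis b_prim : forall j, primitive (b j).
Hypothesis b_dual : forall i j,
  \sum_(w : m.-bseq 'I_d | size w == wt i) D w i * b j w = (j == i)%:R.

Local Notation S := {mpoly F[N]}.

(** The Lie element [\sum_j t_j b_j] with indeterminate coordinates. *)
Definition generic_elt : ncseries S d := fun w => \sum_j b j w *: 'X_j.

Definition coord (w : seq 'I_d) : S := algexp generic_elt w.

Lemma generic_elt_primitive : primitive generic_elt.
Proof.
split=> [|u v u_gt0 v_gt0].
  by rewrite /generic_elt big1 // => j _; rewrite (b_prim j).1 scale0r.
rewrite /coprod exchange_big big1 // => j _ /=.
by rewrite -scaler_suml -/(coprod _ _ _) (b_prim j).2 // scale0r.
Qed.

Lemma generic_pow_homog n w :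
  ncpow generic_elt n w \is (size w).-homog for (weight wt).
Proof.
have f_homog v : generic_elt v \is (size v).-homog for (weight wt).
  apply: rpred_sum => j _; have [eq_v|neq_v] := eqVneq (size v) (wt j).
    by apply/rpredZ; rewrite dhomogX /= weight1 eq_v.
  by rewrite b_homog // scale0r; exact: dhomog0.
elim: n w => [|n IHn] w.
  rewrite /ncpow /= /nc1; case: w => [|a w]; last exact: dhomog0.
  exact: dhomog1.
rewrite ncpowS; apply: rpred_sum => i _.
have := dhomogM (f_homog (take i w)) (IHn (drop i w)).
by rewrite -size_cat cat_take_drop.
Qed.

Lemma coord_homog w : coord w \is (size w).-homog for (weight wt).
Proof. by apply: rpred_sum => n _; apply/rpredZ/generic_pow_homog. Qed.

Lemma generic_pow_dhomog n w : ncpow generic_elt n w \is n.-homog.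
Proof.
elim: n w => [|n IHn] w.
  by rewrite /ncpow /= /nc1; case: (_ == _); [exact: dhomog1 | exact: dhomog0].
rewrite ncpowS; apply: rpred_sum => i _; rewrite -[n.+1]add1n.
apply: dhomogM (IHn _); apply: rpred_sum => j _; apply/rpredZ.
by rewrite dhomogX /= mdeg1.
Qed.

(** Only the power of exponent 1 contributes to the linear part, since the
    [n]-th power is homogeneous of degree [n] in the variables. *)
Lemma coord_linear_part w (mu : 'X_{1..N}) :
  w != [::] -> (mdeg mu <= 1)%N -> (coord w)@_mu = (generic_elt w)@_mu.
Proof.
move=> w_neq0 le_mu1; rewrite /coord /algexp raddf_sum /=.
have pow1 : ncpow generic_elt 1 w = generic_elt w.
  rewrite ncpowS /ncmul big_ord_recr /= take_size drop_size /ncpow /= /nc1 mulr1.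
  rewrite big1 ?add0r // => i _.
  by rewrite -size_eq0 size_drop subn_eq0 leqNgt ltn_ord mulr0.
case: w w_neq0 pow1 => // a w _ pow1.
rewrite 2!big_ord_recl /= pow1 [_ + _ in LHS]addrA big1 ?addr0 => [|n _].
  by rewrite !mcoeffZ /ncpow /= /nc1 /= mcoeff0 mulr0 add0r invr1 mul1r.
rewrite mcoeffZ (dhomog_nemf_coeff (generic_pow_dhomog _ _)) ?mulr0 //=.
by apply: contraTneq le_mu1 => ->.
Qed.

Inductive word_span (e : nat) : S -> Prop :=
  | WSpanCoord w : size w = e -> word_span e (coord w)
  | WSpan0 : word_span e 0
  | WSpanLin c p q : word_span e p -> word_span e q -> word_span e (c *: p + q).

Lemma word_span_sum e (I : Type) (r : seq I) (P : pred I)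
    (c : I -> F) (G : I -> S) :
  (forall i, P i -> word_span e (G i)) ->
  word_span e (\sum_(i <- r | P i) c i *: G i).
Proof.
move=> spanG; elim: r => [|i r IHr]; first by rewrite big_nil; exact: WSpan0.
by rewrite big_cons; case: ifP => // Pi; apply: WSpanLin; first exact: spanG.
Qed.

Lemma word_span_mul e f p q :
  word_span e p -> word_span f q -> word_span (e + f) (p * q).
Proof.
move=> span_p span_q; elim: span_p => [u sz_u||c p1 p2 _ IH1 _ IH2].
- elim: span_q => [v sz_v||c q1 q2 _ IH1 _ IH2].
  + rewrite /coord algexp_shuffle; last exact: generic_elt_primitive.
    rewrite big_seq; under eq_bigr do rewrite -[algexp _ _]scale1r.
    apply: (word_span_sum _ (fun=> 1)) => w /size_shuffle sz_w.
    by apply: WSpanCoord; rewrite sz_w sz_u sz_v.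
  + by rewrite mulr0; exact: WSpan0.
  + by rewrite mulrDr -scalerAr; apply: WSpanLin.
- by rewrite mul0r; exact: WSpan0.
- by rewrite mulrDl -scalerAl; apply: WSpanLin.
Qed.

(** Induction on the weight.  A monomial of degree at least 2 is a product of
    monomials of smaller weight.  For a variable, the dual basis gives a
    combination [Q] of coefficients whose linear part is this variable; the
    other monomials of [Q] have the same weight and degree at least 2, so that
    they are already known to be in the span. *)
Lemma word_span_monomial (mu : 'X_{1..N}) : word_span (weight wt mu) 'X_[mu].
Proof.
have [e] := ubnP (weight wt mu); elim: e mu => // e IHe mu; rewrite ltnS => le_mu.
have big_case nu : (weight wt nu <= e)%N -> (1 < mdeg nu)%N ->
    word_span (weight wt nu) 'X_[nu].
  move=> le_nu nu_big.
  have [i nu_i] : exists i, nu i != 0%N.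
    apply/existsP; apply: contraTT nu_big => /existsPn nu0.
    rewrite (_ : nu = 0%MM) ?mdeg0 //; apply/mnmP=> i; rewrite mnm0E.
    exact/eqP/negbNE/nu0.
  have eq_nu : nu = (U_(i) + (nu - U_(i)))%MM.
    by rewrite addmC submK // lep1mP.
  have rest_neq0 : (nu - U_(i))%MM != 0%MM.
    by apply: contraTneq nu_big => nu0; rewrite eq_nu nu0 addm0 mdeg1.
  have eq_w := congr1 (weight wt) eq_nu; rewrite weightD weight1 in eq_w.
  have rest_gt0 : (0 < weight wt (nu - U_(i)))%N by rewrite lt0n weight_eq0.
  rewrite eq_nu weightD mpolyXD; apply: word_span_mul; apply: IHe.
    rewrite weight1; apply: leq_trans le_nu.
    by rewrite eq_w -[X in (X < _)%N]addn0 ltn_add2l.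
  by apply: leq_trans le_nu; rewrite eq_w -[X in (X < _)%N]add0n ltn_add2r.
have [gt1|le1] := ltnP 1 (mdeg mu); first exact: big_case.
have [mu0|mu_neq0] := eqVneq mu 0%MM.
  rewrite mu0 weight0 mpolyX0.
  suff -> : 1 = coord [::] by apply: WSpanCoord.
  by rewrite /coord /algexp big_ord1 invr1 scale1r /ncpow /= /nc1 eqxx.
have /mdeg1P[i /eqP eq_mu] : mdeg mu == 1%N by rewrite eqn_leq le1 lt0n mdeg_eq0.
subst mu; rewrite weight1 in le_mu *.
pose Q := \sum_(w : m.-bseq 'I_d | size w == wt i) D w i *: coord w.
have spanQ : word_span (wt i) Q.
  by apply: word_span_sum => w /eqP sz_w; apply: WSpanCoord.
have Q_homog : Q - 'X_i \is (wt i).-homog for (weight wt).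
  apply: rpredB; last by rewrite dhomogX /= weight1.
  by apply: rpred_sum => w /eqP <-; apply/rpredZ/coord_homog.
have Q_lin nu : (mdeg nu <= 1)%N -> (Q - 'X_i)@_nu = 0.
  move=> le_nu; rewrite mcoeffB raddf_sum /=.
  under eq_bigr => w /eqP sz_w.
    rewrite mcoeffZ coord_linear_part //; last first.
      by rewrite -size_eq0 sz_w -lt0n.
    rewrite /generic_elt raddf_sum mulr_sumr.
    under eq_bigr do rewrite /= mcoeffZ mulrA.
    over.
  rewrite exchange_big /=; under eq_bigr do rewrite -mulr_suml b_dual.
  rewrite (bigD1 i) //= eqxx mul1r big1 ?addr0 ?subrr // => j /negbTE->.
  by rewrite mul0r.
have -> : 'X_i = -1 *: (Q - 'X_i) + Q by rewrite scaleN1r opprB subrK.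
apply: WSpanLin => //; rewrite [Q - _]mpolyE big_seq.
apply: word_span_sum => nu nu_in.
have wt_nu : weight wt nu = wt i := dhomog_mf Q_homog nu_in.
rewrite -wt_nu; apply: big_case; first by rewrite wt_nu.
rewrite ltnNge; apply: contraL nu_in => /Q_lin Q0.
by rewrite mcoeff_msupp Q0 eqxx.
Qed.

End Coordinates.

(** * The rough Veronese variety *)

Section VeroneseCorestriction.
Variables (K : fieldType) (n : nat) (mf : measure n) (k : nat) (A : nzRingType).
Variables (f : {rmorphism A -> {mpoly K[n]}}).
Hypothesis f_veronese : forall a, f a \in @veronese_pred K n mf k.

Definition veronese_corestr (a : A) : veronese K mf k :=
  Veronese (f_veronese a).

Lemma veronese_corestr_zmod : zmod_morphism veronese_corestr.
Proof. by move=> x y; apply: val_inj; rewrite /= rmorphB. Qed.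

Lemma veronese_corestr_monoid : monoid_morphism veronese_corestr.
Proof. by split=> [|x y]; apply: val_inj; rewrite /= ?rmorph1 ?rmorphM. Qed.

HB.instance Definition _ :=
  GRing.isZmodMorphism.Build A (veronese K mf k) veronese_corestr
    veronese_corestr_zmod.
HB.instance Definition _ :=
  GRing.isMonoidMorphism.Build A (veronese K mf k) veronese_corestr
    veronese_corestr_monoid.
End VeroneseCorestriction.

Section Parametrization.
Variables (F : numFieldType) (d m N : nat).
Variables (wt : 'I_N -> nat) (b : 'I_N -> ncseries F d).
Variable D : seq 'I_d -> 'I_N -> F.
Hypothesis wt_bd : forall j, (0 < wt j <= m)%N.
Hypothesis b_homog : forall j w, size w != wt j -> b j w = 0.
Hypothesis b_prim : forall j, primitive (b j).
Hypothesis b_dual : forall i j,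
  \sum_(w : m.-bseq 'I_d | size w == wt i) D w i * b j w = (j == i)%:R.
Variable k : nat.
Hypothesis k_gt0 : (0 < k)%N.
Hypothesis dvd_k : forall i, (1 <= i <= m)%N -> (i %| k)%N.

Local Notation S := {mpoly F[N]}.

Definition word_coords : (nb_words d k).-tuple S :=
  [tuple coord b (enum_val j : k.-tuple 'I_d) | j < nb_words d k].

Definition pullback : {rmorphism {mpoly F[nb_words d k]} -> S} :=
  comp_mpoly word_coords.

Lemma pullbackE p : pullback p = p \mPo word_coords. Proof. by []. Qed.

Lemma pullback_homog e p :
  p \is e.-homog -> pullback p \is (e * k)%N.-homog for (weight wt).
Proof.
move=> p_homog; rewrite pullbackE comp_mpolyE big_seq.
apply: rpred_sum => mu mu_in; apply/rpredZ.
have -> : (e * k = \sum_i mu i * k)%N.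
  by rewrite -big_distrl /= -mdegE (dhomog_mf p_homog mu_in).
apply: (big_ind2 (fun q l => q \is l.-homog for (weight wt))) => [|q1 l1 q2 l2|i _].
- exact: dhomog1.
- exact: dhomogM.
rewrite mulnC; apply: dhomogMn; rewrite tnth_mktuple.
by have := coord_homog b_homog (enum_val i : k.-tuple 'I_d); rewrite size_tuple.
Qed.

Lemma pullback_veronese p : pullback p \in @veronese_pred F N (weight wt) k.
Proof.
rewrite [p in pullback p](pihomog_partitionE (leqnn (msize p))) rmorph_sum.
apply: rpred_sum => e _; apply/veroneseP => mu mu_in.
by rewrite (dhomog_mf (pullback_homog (pihomogP _ _ _)) mu_in) dvdn_mull.
Qed.

(** As the pullback multiplies degrees by [k], it commutes with homogeneous
    components; so its kernel is a homogeneous ideal. *)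
Lemma pullback_pihomog e p :
  pullback (pihomog mdeg e p) = pihomog (weight wt) (e * k) (pullback p).
Proof.
have hom e' : pullback (pihomog mdeg e' p) \is (e' * k)%N.-homog for (weight wt).
  exact/pullback_homog/pihomogP.
have eq_pb : pullback p = \sum_(e' < msize p) pullback (pihomog mdeg e' p).
  by rewrite -rmorph_sum -pihomog_partitionE.
rewrite eq_pb (raddf_sum (pihomog (weight wt) (e * k))).
have [lt_e|le_e] := ltnP e (msize p).
  rewrite [RHS](bigD1 (Ordinal lt_e)) //= [X in _ = _ + X]big1 ?addr0 => [|e' neq_e'].
    by rewrite (pihomog_dE (hom e)).
  apply: pihomog_ne0 (hom e').
  by rewrite eqn_pmul2r //; exact: neq_e'.
rewrite [RHS]big1 => [|e' _]; last first.
  apply: pihomog_ne0 (hom e').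
  by rewrite eqn_pmul2r // neq_ltn (leq_trans (ltn_ord e') le_e).
rewrite pihomogE big1_seq ?rmorph0 // => mu /andP[/eqP eq_e /msize_mdeg_lt].
by rewrite /= in eq_e *; rewrite eq_e ltnNge le_e.
Qed.

(** A monomial of weight [l * k] is split into [l] monomials of weight [k], one
    at a time; each of them is in the span of the images of the variables. *)
Lemma pullback_surj p :
  p \in @veronese_pred F N (weight wt) k -> exists q, pullback q = p.
Proof.
have wt_gt0 j : (0 < wt j)%N by case/andP: (wt_bd j).
have imM p1 p2 : (exists q, pullback q = p1) -> (exists q, pullback q = p2) ->
    exists q, pullback q = p1 * p2.
  by move=> [q1 <-] [q2 <-]; exists (q1 * q2); rewrite rmorphM.
have imL c p1 p2 : (exists q, pullback q = p1) -> (exists q, pullback q = p2) ->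
    exists q, pullback q = c *: p1 + p2.
  move=> [q1 <-] [q2 <-]; exists (c *: q1 + q2).
  by rewrite rmorphD !pullbackE comp_mpolyZ.
have im0 : exists q, pullback q = 0 by exists 0; rewrite rmorph0.
have im_span p1 : word_span b k p1 -> exists q, pullback q = p1.
  elim=> [w sz_w||c q1 q2 _ im1 _ im2]; [|exact: im0|exact: imL].
  have szw : size w == k by apply/eqP.
  exists 'X_(enum_rank (Tuple szw)).
  rewrite pullbackE comp_mpolyXU -tnth_nth tnth_mktuple.
  by rewrite enum_rankK.
have im_mono mu : (k %| weight wt mu)%N -> exists q, pullback q = 'X_[mu].
  have [l] := ubnP (weight wt mu); elim: l mu => // l IHl mu lt_mu dvd_mu.
  have [->|mu_neq0] := eqVneq mu 0%MM; first by exists 1; rewrite rmorph1 mpolyX0.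
  have [mu1 [mu2 [eq_mu wt_mu1]]] :=
    exists_submonomial k_gt0 dvd_k wt_bd mu_neq0 dvd_mu.
  rewrite eq_mu mpolyXD; apply: imM.
    by apply: im_span; rewrite -wt_mu1; apply: word_span_monomial b_dual _.
  have eq_w : weight wt mu = (k + weight wt mu2)%N by rewrite eq_mu weightD wt_mu1.
  apply: IHl; last by rewrite eq_w dvdn_addr in dvd_mu.
  rewrite eq_w ltnS in lt_mu; apply: leq_trans lt_mu.
  by rewrite -[X in (X < _)%N]add0n ltn_add2r.
move=> /veroneseP vp; rewrite [p]mpolyE big_seq.
apply: (big_ind (fun p => exists q, pullback q = p)) => [|p1 p2 im1 im2|mu mu_in].
- exact: im0.
- by rewrite -[p1]scale1r; apply: imL.
- by rewrite -[_ *: _]addr0; apply: imL => //; apply/im_mono/vp.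
Qed.

End Parametrization.

Lemma meval_homog_scale (K : fieldType) n e (p : {mpoly K[n]}) (c : K)
    (v : 'rV[K]_n) :
  p \is e.-homog -> p.@[(c *: v) 0] = c ^+ e * p.@[v 0].
Proof.
move=> p_homog; rewrite !mevalE mulr_sumr; apply: eq_big_seq => mu mu_in.
rewrite mulrCA; congr (_ * _).
have <- : mdeg mu = e := dhomog_mf p_homog mu_in.
rewrite mdegE -prodrXr -big_split /=.
by apply: eq_bigr => i _; rewrite mxE exprMn.
Qed.

Lemma ncpow_rmorph (K K' : nzRingType) d (h : {rmorphism K -> K'})
    (f : ncseries K d) n w :
  h (ncpow f n w) = ncpow (h \o f) n w.
Proof.
elim: n w => [|n IHn] w.
  by rewrite /ncpow /= /nc1; case: eqP; rewrite ?rmorph1 ?rmorph0.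
by rewrite /ncpow !iterS rmorph_sum; apply: eq_bigr => i _; rewrite rmorphM /= IHn.
Qed.

Lemma primitive_rmorph (K K' : comNzRingType) d (h : {rmorphism K -> K'})
    (f : ncseries K d) :
  primitive f -> primitive (h \o f).
Proof.
move=> [f0 pf]; split=> [|u v u_gt0 v_gt0]; first by rewrite /= f0 rmorph0.
by rewrite /coprod -rmorph_sum -/(coprod _ _ _) pf // rmorph0.
Qed.

Lemma coord_eval (R : realType) d N (b : 'I_N -> ncseries R d) (t : 'I_N -> R) w :
  (coord (fun j => real_complex R \o b j) w).@[fun j => real_complex R (t j)] =
  real_complex R (ncexp (fun w => \sum_j t j * b j w) w).
Proof.
rewrite /coord /algexp /ncexp !rmorph_sum; apply: eq_bigr => n _ /=.
rewrite mevalZ rmorphM fmorphV rmorph_nat mulrC; congr (_ * _).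
rewrite !ncpow_rmorph; congr (ncpow _ _ _); apply/funext=> v /=.
rewrite /generic_elt !rmorph_sum; apply: eq_bigr => j _ /=.
by rewrite mevalZ mevalXU rmorphM mulrC.
Qed.

Theorem theorem2p19 (R : realType) (d k m : nat)
    (d_ge2 : (2 <= d)%N) (k_ge1 : (1 <= k)%N) (m_ge1 : (1 <= m)%N)
    (dvd_k : forall i : nat, (1 <= i <= m)%N -> (i %| k)%N) :
  projectively_normal (rough_veronese R d k m).
Proof.
have [N [wt [b [D [wt_bd b_homog b_lie lie_span b_dual]]]]] :=
  homogeneous_lie_basis R d m.
pose C : {rmorphism R -> R[i]} := real_complex R.
pose bC j : ncseries R[i] d := C \o b j.
have bC_homog j w : size w != wt j -> bC j w = 0.
  by move=> neq_w; rewrite /bC /= b_homog ?rmorph0.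
have bC_prim j : primitive (bC j).
  by apply/primitive_rmorph/primitive_lie.
have bC_dual i j :
    \sum_(w : m.-bseq 'I_d | size w == wt i) C (D w i) * bC j w = (j == i)%:R.
  have := congr1 C (b_dual i j); rewrite rmorph_nat rmorph_sum => <-.
  by apply: eq_bigr => w _; rewrite rmorphM.
pose pb := @pullback R[i] d N bC k.
have pb_eval f t : (pb f).@[fun j => C (t j)] =
    f.@[(rough_veronese_map k (fun w => \sum_j t j * b j w)) 0].
  rewrite /pb pullbackE comp_mpoly_meval; apply: meval_eq => j.
  by rewrite tnth_mktuple coord_eval !mxE.
exists (veronese R[i] (weight wt) k).
exists (veronese_corestr (pullback_veronese (k := k) bC_homog)).
split; last exact: veronese_integrally_closed.
split=> [a|f].
  have [q eq_q] := pullback_surj (D := fun w i => C (D w i)) wt_bd bC_homog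
    bC_prim bC_dual k_ge1 dvd_k (valP a).
  by exists q; apply: val_inj.
have -> : veronese_corestr (pullback_veronese (k := k) bC_homog) f = 0 <->
    pb f = 0.
  by split=> [/(congr1 val)|eq0]; [|apply: val_inj].
split=> [pbf0 v|f_van].
  (* The closure of the image lies in the common zeros of the homogeneous
     components of [f], which are all in the kernel. *)
  have cone_in : (affine_cone (rough_veronese R d k m) `<=`
      [set v | forall e, (pihomog mdeg e f).@[v 0] = 0])%classic.
    have hom_zero e L c : lie_trunc R d m L ->
        (pihomog mdeg e f).@[(c *: rough_veronese_map k L) 0] = 0.
      move=> /lie_span[t ->]; rewrite (meval_homog_scale _ _ (pihomogP _ _ _)).
      rewrite -pb_eval /pb (pullback_pihomog bC_homog) // -/pb pbf0.
      by rewrite pihomog0 meval0 mulr0.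
    have lie_trunc0 : lie_trunc R d m (fun=> 0).
      apply/lie_span; exists (fun=> 0); apply/funext=> w.
      by rewrite big1 // => j _; rewrite mul0r.
    move=> w [-> e|[U XU wU] e].
      (* The origin is the zero multiple of any point of the image. *)
      by rewrite -(scale0r (rough_veronese_map k (fun=> 0))) hom_zero.
    pose G := [set g | exists e, g = pihomog mdeg e f]%classic.
    have closedG : proj_closed (proj_zeros G).
      by exists G => // _ [e' ->]; exists e'; exact: pihomogP.
    suff : proj_zeros G U by move=> /(_ (pihomog mdeg e f)); apply=> //; exists e.
    apply: XU; split=> // _ [L [L_neq0 [lie_L ->]]] _ [e' ->] u /vlineP[c ->].
    exact: hom_zero.
  move=> Zv; rewrite [f](pihomog_partitionE (leqnn (msize f))) rmorph_sum big1 //= => e _.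
  exact: cone_in.
(* A real point where the pullback does not vanish would be mapped to a point of
   the cone where [f] does not vanish. *)
apply: contrapT => /eqP /exists_nat_nonroot[n]; apply/negP/negPn/eqP.
have eq_n : (fun i => (n i)%:R) = (fun i => C (n i)%:R) :> ('I_N -> R[i]).
  by apply/funext=> i; rewrite rmorph_nat.
rewrite eq_n pb_eval; apply: f_van.
set L := (fun w => _).
have [->|L_neq0] := eqVneq (rough_veronese_map k L) 0; first by left.
right; exists (proj_point L_neq0); last exact: memv_line.
apply: sub_gen_smallest; exists L, L_neq0; split=> //.
by apply/lie_span; exists (fun j => (n j)%:R).
Qed.
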